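(* Let $V_0\in L^2(\mathbb{T}^d;\mathbb{R}^d)$ be a divergence-free vector field of zero spatial mean with $\nabla V_0\in L^2(\mathbb{T}^d;\mathbb{R}^{d\times d})$. Then, as $\nu\to0^+$, $$\widetilde{\mathcal{A}^\nu_{NS}}\ \stackrel{\Gamma}{\longrightarrow}\ \widetilde{\mathcal{A}^0_{NS}}\quad\text{in the metric space }\ \widetilde{\mathcal{EB}\Psi_{2,\infty,2}}.$$
   Context: Here $d\in\{2,3\}$, $\mathbb{T}^d=\mathbb{R}^d/\mathbb{Z}^d$, $T>0$, $a_V>0$, $a_W>0$, $\bar V\in L^2(0,T;L^2(\mathbb{T}^d;\mathbb{R}^d))$, $\bar W\in L^2(0,T;L^2(\mathbb{T}^d;\mathbb{R}^{d\times d}))$ are fixed, $\alpha$ is a fixed exponent with $0<\alpha<\frac{1}{[d/2]+4}$ ($[\cdot]$ the integer part), with $0^\alpha=0$, repeated indices are summed from $1$ to $d$, and $\partial_i$, $\nabla$, $\Delta$ act in the space variable; $\Delta^{-1}$ is the inverse Laplacian on mean-zero functions/distributions on $\mathbb{T}^d$. For $\nu\ge0$, $\mathcal{EB}\Psi^\nu_{2,\infty,2}$ is the class of all triples $(\mathbb{E},B,\chi)$ in $L^2\times L^\infty\times L^2$ on $[0,T]\times\mathbb{T}^d$, with $\mathbb{E}$ valued in $\mathbb{R}^d$ and $B,\chi$ valued in symmetric $d\times d$ matrices, satisfying weakly, together with $B(T,\cdot)\equiv0$, $$\partial_tB_{ij}=\tfrac12(\partial_j\mathbb{E}_i+\partial_i\mathbb{E}_j)-\partial_i\partial_j\Delta^{-1}(\partial_l\mathbb{E}_l-2\nu\,\partial_l\partial_k\chi_{lk})-\nu(\partial_j\partial_l\chi_{li}+\partial_i\partial_l\chi_{lj}),$$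 that is, for every smooth symmetric-matrix-valued $\psi$ on $[0,T]\times\mathbb{T}^d$ with $\psi(0,\cdot)=0$, $$-\int_0^T\!\!\int_{\mathbb{T}^d}B_{ij}\partial_t\psi_{ij}=\int_0^T\!\!\int_{\mathbb{T}^d}\Big(-\mathbb{E}_i\partial_j\psi_{ij}+\mathbb{E}_l\partial_l\Delta^{-1}\partial_i\partial_j\psi_{ij}+2\nu\chi_{lk}\partial_l\partial_k\Delta^{-1}\partial_i\partial_j\psi_{ij}-2\nu\chi_{li}\partial_l\partial_j\psi_{ij}\Big).$$ The metric space is $\widetilde{\mathcal{EB}\Psi_{2,\infty,2}}:=\bigcup_{\nu\ge0}\mathcal{EB}\Psi^\nu_{2,\infty,2}$ with metric $$d((\mathbb{E}_1,B_1,\chi_1),(\mathbb{E}_2,B_2,\chi_2))=\|\mathbb{E}_1-\mathbb{E}_2\|_{L^2(0,T;L^2)}+\|B_1-B_2\|_{L^\infty(0,T;L^\infty)}+\|\chi_1-\chi_2\|_{L^2(0,T;L^2)}.$$ For $\mathbb{E}\in L^2([0,T]\times\mathbb{T}^d;\mathbb{R}^d)$ and a bounded symmetric-matrix field $N$, define $$\mathcal{M}[\mathbb{E},N]:=\sup_{M\ge Z\otimes Z}\ \frac12\int_0^T\!\!\int_{\mathbb{T}^d}2\mathbb{E}_iZ^i-N_{ij}M^{ij}\,dx\,dt\in[0,+\infty],$$ the supremum over all continuous $Z:[0,T]\times\mathbb{T}^d\to\mathbb{R}^d$ and continuous symmetric-matrix-valued $M$ with $Z\otimes Z\le M$ (formally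 $\mathcal{M}[\mathbb{E},N]=\frac12\int_0^T\!\int_{\mathbb{T}^d}\mathbb{E}_i(N^{-1})^{ij}\mathbb{E}_j$). With $N(a,B):=a\,\mathrm{Id}+2B$, for $\nu\ge0$, $$\mathcal{A}^\nu_{NS}(\mathbb{E},B,\chi):=\mathcal{M}\big[\mathbb{E}-(a_V+\nu^\alpha)\bar V,\,N(a_V+\nu^\alpha,B)\big]+\int_0^T\!\!\int_{\mathbb{T}^d}\big(V_0^i\mathbb{E}_i+2\nu\,\partial_lV_0^i\chi_{il}\big)\,dx\,dt$$ $$+\int_0^T\!\!\int_{\mathbb{T}^d}\frac1{2a_W}|\chi-B-a_W\bar W|^2\,dx\,dt-\int_0^T\!\!\int_{\mathbb{T}^d}\frac{a_V+\nu^\alpha}{2}|\bar V|^2+\frac{a_W}{2}|\bar W|^2\,dx\,dt$$ ($|\cdot|$ the Euclidean/Frobenius norm), and $\widetilde{\mathcal{A}^\nu_{NS}}:\widetilde{\mathcal{EB}\Psi_{2,\infty,2}}\to(-\infty,+\infty]$ equals $\mathcal{A}^\nu_{NS}$ on $\mathcal{EB}\Psi^\nu_{2,\infty,2}$ and $+\infty$ on the complement. *)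

(* Defs.v *)
From HB Require Import structures.
From mathcomp Require Import all_boot all_order all_algebra.
From mathcomp Require Import all_classical all_reals all_analysis.
Set Implicit Arguments.
Unset Strict Implicit.
Unset Printing Implicit Defensive.
Import Order.TTheory GRing.Theory Num.Theory.
Import numFieldNormedType.Exports.
Local Open Scope classical_set_scope.
Local Open Scope ring_scope.

(* D is the underlying set of the space; dist need only be a pseudometric
   on it (points at distance zero are identified). *)
Section gamma_convergence.
Context {R : realType} {X : Type}.
Variables (D : set X) (dist : X -> X -> \bar R).

Definition dist_cvg (u : nat -> X) (x : X) : Prop :=
  dist (u n) x @[n --> \oo] --> 0%E.

Definition gamma_cvg (F : nat -> X -> \bar R) (G : X -> \bar R) : Prop :=
  (forall x, D x -> forall u : nat -> X, (forall n, D (u n)) ->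
     dist_cvg u x -> (G x <= limn_einf (fun n => F n (u n)))%E) /\
  (forall x, D x -> exists u : nat -> X,
     [/\ forall n, D (u n), dist_cvg u x &
         (limn_esup (fun n => F n (u n)) <= G x)%E]).

Definition gamma_cvg_0plus (F : R -> X -> \bar R) (G : X -> \bar R) : Prop :=
  forall nu : nat -> R, (forall n, 0 < nu n) -> nu n @[n --> \oo] --> 0 ->
    gamma_cvg (fun n => F (nu n)) G.

End gamma_convergence.

(* As a measure space, R^d / Z^d is the unit cube with Lebesgue measure.
   Points are tuples, because these carry the product sigma-algebra. *)
Notation torus R d := (d.-tuple (measurableTypeR R)).
Notation spacetime R d := (measurableTypeR R * torus R d)%type.

Section measures.
Context {R : realType}.

Definition cube_cons (n : nat) (p : spacetime R n) : torus R n.+1 :=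
  [tuple of p.1 :: p.2].

Lemma measurable_cube_cons n : measurable_fun setT (@cube_cons n).
Proof. exact: measurable_cons measurable_fst measurable_snd. Qed.

HB.instance Definition _ n :=
  isMeasurableFun.Build _ _ _ _ (@cube_cons n) (@measurable_cube_cons n).

(* [uniform_prob (@ltr01 R)] is Lebesgue measure restricted to [0, 1]. *)
Fixpoint cube_measure (n : nat) : probability (torus R n) R :=
  match n with
  | 0 => dirac ([tuple] : torus R 0)
  | n'.+1 => distribution (uniform_prob (@ltr01 R) \x cube_measure n')%E
               (@cube_cons n')
  end.

Lemma lebesgue_measure_itv_lty (T : R) :
  (@lebesgue_measure R `[0%R, T]%classic < +oo)%E.
Proof. by rewrite lebesgue_measure_itv; case: ifP; rewrite ltry. Qed.

Definition time_measure (T : R) :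
    {finite_measure set (measurableTypeR R) -> \bar R} :=
  @mfrestr _ (measurableTypeR R) R `[0%R, T]%classic (@lebesgue_measure R)
    (measurable_itv `[0%R, T]) (lebesgue_measure_itv_lty T).

Definition spacetime_measure (T : R) (d : nat) :
    {measure set (spacetime R d) -> \bar R} :=
  (time_measure T \x cube_measure d)%E.

End measures.

Section Lp_fields.
Context {R : realType}.

(* Frobenius norm; on row vectors, the Euclidean norm. *)
Definition frob (m n : nat) (A : 'M[R]_(m, n)) : R :=
  Num.sqrt (\sum_i \sum_j A i j ^+ 2).

Context {disp : measure_display} {X : measurableType disp}.
Variables (mu : {measure set X -> \bar R}) (p : \bar R) (m n : nat).

Definition Lp_field (F : X -> 'M[R]_(m, n)) : Prop :=
  forall i j, (fun x => F x i j) \in Lfun mu p.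

Definition Lp_norm (F : X -> 'M[R]_(m, n)) : \bar R :=
  Lnorm mu p (fun x => (frob (F x))%:E).

End Lp_fields.

Section smooth.
Context {R : realType}.

Fixpoint continuously_diff (V : normedModType R) (n : nat) (f : V -> R) : Prop :=
  match n with
  | 0 => continuous f
  | n'.+1 => (forall x, differentiable f x) /\
             (forall v, continuously_diff n' ('D_v f))
  end.

Definition smooth (V : normedModType R) (f : V -> R) : Prop :=
  forall n, continuously_diff n f.

End smooth.

Section calculus.
Context {R : realType} {d : nat}.

(* Functions on the torus that are required to be continuous or smooth are
   Z^d-periodic functions on R^d = 'rV[R]_d; [row_of] and [point_of] evaluate
   them at the points of the measure space. *)
Definition row_of (x : torus R d) : 'rV[R]_d := \row_i tnth x i.
Definition point_of (q : spacetime R d) : R * 'rV[R]_d := (q.1, row_of q.2).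

Definition space_periodic (Y : Type) (f : 'rV[R]_d -> Y) : Prop :=
  forall x (i : 'I_d), f (x + delta_mx 0 i) = f x.

Definition periodic_in_space (Y : Type) (f : R * 'rV[R]_d -> Y) : Prop :=
  forall t, space_periodic (fun x => f (t, x)).

Definition space_dx (i : 'I_d) (f : 'rV[R]_d -> R) : 'rV[R]_d -> R :=
  'D_(delta_mx 0 i) f.

Definition dt (f : R * 'rV[R]_d -> R) : R * 'rV[R]_d -> R := 'D_(1, 0) f.
Definition dx (i : 'I_d) (f : R * 'rV[R]_d -> R) : R * 'rV[R]_d -> R :=
  'D_(0, delta_mx 0 i) f.

Definition laplacian (f : R * 'rV[R]_d -> R) : R * 'rV[R]_d -> R :=
  fun p => \sum_l dx l (dx l f) p.

(* The inverse Laplacian in the space variable: the smooth periodic solution g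
   of laplacian g = f with zero spatial mean at each time (it is unique when it
   exists, and it exists for f smooth, periodic and of zero spatial mean). *)
Definition inv_laplacian (f : R * 'rV[R]_d -> R) : R * 'rV[R]_d -> R :=
  xget (fun=> 0) [set g | [/\ smooth g, periodic_in_space g,
    forall t, (\int[cube_measure d]_x g (t, row_of x)) = 0 &
    laplacian g = f]].

(* G i l is the weak derivative of the i-th component of V along x_l. *)
Definition weak_gradient (V : torus R d -> 'rV[R]_d) (G : torus R d -> 'M[R]_d) :
    Prop :=
  forall phi : 'rV[R]_d -> R, smooth phi -> space_periodic phi ->
  forall i l : 'I_d,
    \int[cube_measure d]_x (V x 0 i * space_dx l phi (row_of x)) =
    - (\int[cube_measure d]_x (G x i l * phi (row_of x))).

Definition divergence_free (V : torus R d -> 'rV[R]_d) : Prop :=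
  forall phi : 'rV[R]_d -> R, smooth phi -> space_periodic phi ->
    \int[cube_measure d]_x (\sum_i V x 0 i * space_dx i phi (row_of x)) = 0.

Definition zero_mean (V : torus R d -> 'rV[R]_d) : Prop :=
  forall i, (\int[cube_measure d]_x V x 0 i) = 0.

End calculus.

Section ebpsi.
Context {R : realType} {d : nat}.

Record triple := Triple {
  tE : spacetime R d -> 'rV[R]_d ;
  tB : spacetime R d -> 'M[R]_d ;
  tchi : spacetime R d -> 'M[R]_d }.

Variable T : R.
Local Notation mu := (spacetime_measure T d).

(* Test fields are smooth on [0, T] x T^d up to the boundary, i.e. restrictions
   of smooth fields on R x T^d. *)
Definition test_field (psi : 'I_d -> 'I_d -> R * 'rV[R]_d -> R) : Prop :=
  [/\ forall i j, smooth (psi i j), forall i j, periodic_in_space (psi i j),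
      forall i j, psi i j = psi j i & forall i j x, psi i j (0, x) = 0].

Definition weak_eq (nu : R) (x : triple) : Prop :=
  forall psi, test_field psi ->
  let phi :=
    inv_laplacian (fun p => \sum_i \sum_j dx i (dx j (psi i j)) p) in
  - (\int[mu]_q (\sum_i \sum_j tB x q i j * dt (psi i j) (point_of q))) =
  \int[mu]_q
    (- (\sum_i \sum_j tE x q 0 i * dx j (psi i j) (point_of q))
     + \sum_l tE x q 0 l * dx l phi (point_of q)
     + 2 * nu * (\sum_l \sum_k tchi x q l k * dx l (dx k phi) (point_of q))
     - 2 * nu * (\sum_l \sum_i \sum_j
                   tchi x q l i * dx l (dx j (psi i j)) (point_of q))).

Definition EBPsi (nu : R) : set triple :=
  [set x | [/\ Lp_field mu 2%:E (tE x), Lp_field mu +oo%E (tB x),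
    Lp_field mu 2%:E (tchi x),
    {ae mu, forall q, tB x q \is symmetricmx /\ tchi x q \is symmetricmx} &
    weak_eq nu x]].

Definition EBPsi_union : set triple :=
  \bigcup_(nu in [set nu : R | 0 <= nu]) EBPsi nu.

Definition EBPsi_dist (x y : triple) : \bar R :=
  (Lp_norm mu 2%:E (fun q => tE x q - tE y q)%R +
   Lp_norm mu +oo (fun q => tB x q - tB y q)%R +
   Lp_norm mu 2%:E (fun q => tchi x q - tchi y q)%R)%E.

Definition psd (A : 'M[R]_d) : Prop := forall v : 'rV[R]_d, 0 <= (v *m A *m v^T) 0 0.

Definition slab : set (R * 'rV[R]_d) := [set p | 0 <= p.1 <= T].

(* Z is a row vector, so Z^T *m Z is the tensor product of Z with itself. *)
Definition admissible (ZM : (R * 'rV[R]_d -> 'rV[R]_d) * (R * 'rV[R]_d -> 'M[R]_d)) :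
    Prop :=
  let Z := ZM.1 in let M := ZM.2 in
  [/\ {within slab, continuous Z} /\ {within slab, continuous M},
      periodic_in_space Z /\ periodic_in_space M,
      forall p, slab p -> M p \is symmetricmx &
      forall p, slab p -> psd (M p - (Z p)^T *m Z p)].

Definition calM (E : spacetime R d -> 'rV[R]_d) (N : spacetime R d -> 'M[R]_d) :
    \bar R :=
  ereal_sup [set (2^-1 * (\int[mu]_q
      ((\sum_i 2 * E q 0 i * ZM.1 (point_of q) 0 i)
       - \sum_i \sum_j N q i j * ZM.2 (point_of q) i j)))%:E
    | ZM in admissible].

Variables (aV aW alpha : R).
Variables (Vbar : spacetime R d -> 'rV[R]_d) (Wbar : spacetime R d -> 'M[R]_d).
Variables (V0 : torus R d -> 'rV[R]_d) (gradV0 : torus R d -> 'M[R]_d).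

Definition Nmat (a : R) (B : spacetime R d -> 'M[R]_d) : spacetime R d -> 'M[R]_d :=
  fun q => a%:M + 2 *: B q.

Definition action_NS (nu : R) (x : triple) : \bar R :=
  let a := aV + nu `^ alpha in
  (calM (fun q => tE x q - a *: Vbar q)%R (Nmat a (tB x)) +
   ((\int[mu]_q ((\sum_i V0 q.2 0 i * tE x q 0 i)
                 + 2 * nu * (\sum_i \sum_l gradV0 q.2 i l * tchi x q i l)))
    + (\int[mu]_q ((2 * aW)^-1 * frob (tchi x q - tB x q - aW *: Wbar q) ^+ 2))
    - (\int[mu]_q (a / 2 * frob (Vbar q) ^+ 2
                   + aW / 2 * frob (Wbar q) ^+ 2)))%R%:E)%E.

Definition action_NS_ext (nu : R) (x : triple) : \bar R :=
  if x \in EBPsi nu then action_NS nu x else +oo%E.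

End ebpsi.

Arguments triple : clear implicits.

(* Main.v *)
(* Lower bound: for a fixed admissible pair (Z, M), everything in the action and
   in the weak equation is continuous along the sequence, and a supremum of
   continuous functionals is lower semicontinuous; since the inverse Laplacian of
   a test field is smooth, the limit of points satisfying the equations with
   viscosities nu_n -> 0 satisfies the inviscid one.

   Upper bound: given (E, B, chi) satisfying the inviscid equation and chi' in L^2
   with divergence in L^2, the triple (E + 2 nu div chi', B, chi') satisfies the
   equation with viscosity nu, with the same B.  As calM is subadditive and
   calM[F, c Id] <= |F|^2 / (2 c), the action increases through calM by at most
     |2 nu div chi' - nu^alpha Vbar|^2 / (2 nu^alpha)
       <= 4 nu^(2 - alpha) |div chi'|^2 + nu^alpha |Vbar|^2,
   so it suffices to let chi' -> chi in L^2 slowly enough.  Such chi' are dense: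
   sets whose indicators are limits of products of smooth one-variable functions
   form a pi-system generating the sigma-algebra. *)

Require Import Defs.
From mathcomp Require Import all_boot all_order all_algebra.
From mathcomp Require Import all_classical all_reals all_analysis.
From mathcomp Require Import measurable_realfun ess_sup_inf ring lra.
Import Order.TTheory GRing.Theory Num.Theory.
Import numFieldNormedType.Exports.
Set Implicit Arguments.
Unset Strict Implicit.
Unset Printing Implicit Defensive.
Local Open Scope classical_set_scope.
Local Open Scope ring_scope.

(** * Square-integrable functions *)

(** Two features of the setting shape the upper bound. The class on which the action may be finite
    changes with [nu]: a triple satisfying the inviscid equation need not satisfy a viscous one, so
    a constant sequence may have infinite action. And [B] is measured in the uniform norm, so that
    smoothing a whole triple would not in general converge in the metric. The correction must
    therefore go into E with [B] frozen; since chi is only square integrable, its divergence is a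
    distribution that cannot be added to E, which is why chi itself has to be replaced.

    What pays for the correction is the gap [nu^alpha Id] between N(aV + nu^alpha, B) and N(aV, B):
    it is uniformly positive definite even where N(aV, B) is not, and it gives the divergence the
    weight nu^2 / nu^alpha.

    Apart from [calM], every term of the action is at most quadratic in fields that converge
    strongly in L2, so Cauchy-Schwarz is enough to pass to the limit. *)

Lemma cvg_eqfun (U : topologicalType) (u v : nat -> U) (l : U) :
  (forall n, u n = v n) -> v n @[n --> \oo] --> l -> u n @[n --> \oo] --> l.
Proof. by move=> /funext ->. Qed.

Lemma cvg_squeeze0 (R : realType) (u v : nat -> R) : (forall n, 0 <= u n <= v n) ->
  v n @[n --> \oo] --> 0 -> u n @[n --> \oo] --> 0.
Proof.
move=> uv v0; apply: (squeeze_cvgr (f := fun=> 0) (h := v)) => //; last exact: cvg_cst.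
exact: nearW.
Qed.

Lemma seq_cvgD (R : realType) (u v : nat -> R) (a b : R) : u n @[n --> \oo] --> a ->
  v n @[n --> \oo] --> b -> u n + v n @[n --> \oo] --> a + b.
Proof. by move=> ua vb; exact: cvgD. Qed.

Lemma seq_cvgM (R : realType) (u v : nat -> R) (a b : R) : u n @[n --> \oo] --> a ->
  v n @[n --> \oo] --> b -> u n * v n @[n --> \oo] --> a * b.
Proof. by move=> ua vb; exact: cvgM. Qed.

Lemma seq_cvgZ (R : realType) (c : R) (u : nat -> R) (a : R) : u n @[n --> \oo] --> a ->
  c * u n @[n --> \oo] --> c * a.
Proof. by move=> ua; apply: seq_cvgM => //; exact: cvg_cst. Qed.

Lemma seq_cvg_cst (R : realType) (c : R) : (fun=> c) n @[n --> \oo] --> c.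
Proof. exact: cvg_cst. Qed.

Section square_integrable.
Context {R : realType} {disp : measure_display} {X : measurableType disp}.
Variable mu : {measure set X -> \bar R}.
Implicit Types (f g h : X -> R).

Notation L2 := (Lfun mu 2%:E).
Notation intble f := (mu.-integrable setT (EFin \o f)).

Lemma L2P f : f \in L2 <->
  measurable_fun setT f /\ (\int[mu]_x ((f x) ^+ 2)%:E < +oo)%E.
Proof.
have E g : (\int[mu]_x (`|(EFin \o g) x| `^ 2) = \int[mu]_x ((g x) ^+ 2)%:E)%E.
  by apply: eq_integral => x _ /=; rewrite powR_mulrn// -normrX ger0_norm ?sqr_ge0.
split.
- move=> /[dup] /Lfun2_integrable_sqr /integrableP[_ h].
  rewrite inE => /andP[]; rewrite !inE/= => mf _; split=> //.
  apply: le_lt_trans h; apply: ge0_le_integral => //=.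
  + by move=> x _; rewrite lee_fin sqr_ge0.
  + by apply/measurable_EFinP; exact: measurable_funX.
  + by do 2 apply: measurableT_comp => //; exact: measurable_funX.
  + by move=> x _; rewrite lee_fin ler_norm.
- move=> [mf fy]; rewrite inE; apply/andP; split; rewrite inE//=.
  by rewrite /finite_norm unlock poweR_lty// E.
Qed.

Lemma L2_measurable f : f \in L2 -> measurable_fun setT f.
Proof. by case/L2P. Qed.

Lemma L2_mul_integrable f g : f \in L2 -> g \in L2 -> intble (fun x => f x * g x).
Proof. by move=> Lf Lg; apply/Lfun1_integrable; exact: Lfun2_mul_Lfun1. Qed.

Lemma L2_sqr_integrable f : f \in L2 -> intble (fun x => f x ^+ 2).
Proof. exact: Lfun2_integrable_sqr. Qed.

Lemma L2_eq f g : f =1 g -> f \in L2 -> g \in L2.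
Proof. by move=> /funext ->. Qed.

Lemma intble_eq f g : f =1 g -> intble f -> intble g.
Proof. by move=> /funext ->. Qed.

Lemma L2D f g : f \in L2 -> g \in L2 -> (fun x => f x + g x) \in L2.
Proof. by move=> Lf Lg; exact: (Lfun_addr_closed mu (lee1n 2)).2. Qed.

Lemma L2Z a f : f \in L2 -> (fun x => a * f x) \in L2.
Proof.
move=> Lf; have := @Lfun_scale _ _ _ mu f a 2 _ Lf.
rewrite (_ : _ \o* _ = (fun x => a * f x)); first by apply; rewrite ler1n.
by apply/funext => x /=; rewrite mulrC.
Qed.

Lemma L2N f : f \in L2 -> (fun x => - f x) \in L2.
Proof.
by move=> /(L2Z (-1)); apply: L2_eq => x; rewrite mulN1r.
Qed.

Lemma L2B f g : f \in L2 -> g \in L2 -> (fun x => f x - g x) \in L2.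
Proof. by move=> Lf Lg; exact/L2D/L2N. Qed.

Lemma L2_sum (I : finType) (F : I -> X -> R) :
  (forall i, F i \in L2) -> (fun x => \sum_i F i x) \in L2.
Proof.
move=> LF; rewrite (_ : (fun x => \sum_i F i x) = \sum_i F i); last first.
  by apply/funext => x; rewrite fct_sumE.
by apply: (big_ind (fun f => f \in L2)) => [|f g|i _]; [
  apply/L2P; split; [exact: measurable_cst|by rewrite integral0_eq// => x _; rewrite expr0n]
  | exact: L2D | exact: LF].
Qed.

Lemma L2_mulb f g (C : R) : f \in L2 -> measurable_fun setT g ->
  {ae mu, forall x, `|g x| <= C} -> (fun x => f x * g x) \in L2.
Proof.
move=> /L2P[mf fy] mg gC; apply/L2P; split; first exact: measurable_funM.
have C0 : {ae mu, forall x, (f x * g x) ^+ 2 <= (C ^+ 2) * (f x) ^+ 2}.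
  apply: filterS gC => x gC; rewrite exprMn mulrC; apply: ler_wpM2r; rewrite ?sqr_ge0//.
  by rewrite -[g x ^+ 2]real_normK ?num_real// ler_sqr ?nnegrE// (le_trans _ gC).
apply: (@le_lt_trans _ _ (\int[mu]_x ((C ^+ 2) * (f x) ^+ 2)%:E)%E).
  apply: ae_ge0_le_integral => //.
  + by move=> x _; rewrite lee_fin sqr_ge0.
  + by apply/measurable_EFinP; apply: measurable_funX; exact: measurable_funM.
  + by move=> x _; rewrite lee_fin mulr_ge0 ?sqr_ge0.
  + apply/measurable_EFinP; apply: measurable_funM => //; exact: measurable_funX.
  + by apply: filterS C0 => x + _; rewrite lee_fin.
under eq_integral do rewrite EFinM.
rewrite ge0_integralZl//.
+ by rewrite lte_mul_pinfty// lee_fin sqr_ge0.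
+ by apply/measurable_EFinP; exact: measurable_funX.
+ by move=> x _; rewrite lee_fin sqr_ge0.
+ by rewrite lee_fin sqr_ge0.
Qed.

Lemma L2_cst : (mu setT < +oo)%E -> forall c, (fun=> c) \in L2.
Proof.
move=> muT c; apply/L2P; split => //.
by rewrite (_ : (fun x => _) = cst (c ^+ 2)%:E)// integral_cst// lte_mul_pinfty// lee_fin sqr_ge0.
Qed.

Lemma L2_bounded g (C : R) : (mu setT < +oo)%E -> measurable_fun setT g ->
  {ae mu, forall x, `|g x| <= C} -> g \in L2.
Proof.
move=> muT mg gC; have := L2_mulb (L2_cst muT 1) mg gC.
by apply: L2_eq => x; rewrite mul1r.
Qed.

Lemma intble_sum (I : finType) (F : I -> X -> R) :
  (forall i, intble (F i)) -> intble (fun x => \sum_i F i x).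
Proof.
move=> LF.
rewrite (_ : _ \o _ = (fun x => \sum_(i <- index_enum I) (EFin \o F i) x)%E); last first.
  by apply/funext => x; rewrite /= sumEFin.
by apply: integrable_sum => // i _; exact: LF.
Qed.

Lemma Rintegral_sum (I : finType) (F : I -> X -> R) :
  (forall i, intble (F i)) ->
  \int[mu]_x (\sum_i F i x) = \sum_i \int[mu]_x F i x.
Proof.
move=> LF; rewrite /Rintegral; under eq_integral do rewrite -sumEFin.
rewrite integral_sum// -[RHS]/(fine (_%:E)) -sumEFin; congr fine.
by apply: eq_bigr => i _; rewrite fineK//; apply: integrable_fin_num => //; exact: LF.
Qed.

Lemma intbleD f g : intble f -> intble g -> intble (fun x => f x + g x).
Proof. by move=> If Ig; exact: (integrableD measurableT If Ig). Qed.

Lemma intbleZ c f : intble f -> intble (fun x => c * f x).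
Proof. by move=> If; exact: (integrableZl measurableT c If). Qed.

Lemma intbleN f : intble f -> intble (fun x => - f x).
Proof.
by move=> /(intbleZ (-1)); apply: intble_eq => x; rewrite mulN1r.
Qed.

Lemma intbleB f g : intble f -> intble g -> intble (fun x => f x - g x).
Proof. by move=> If Ig; exact/intbleD/intbleN. Qed.

Lemma RintegralN f : intble f -> \int[mu]_x (- f x) = - \int[mu]_x f x.
Proof.
by move=> If; rewrite -mulN1r -RintegralZl//; apply: eq_Rintegral => x _; rewrite mulN1r.
Qed.

Lemma ae_le_Rintegral f g : intble f -> intble g -> {ae mu, forall x, f x <= g x} ->
  \int[mu]_x f x <= \int[mu]_x g x.
Proof.
move=> If Ig fg; rewrite -subr_ge0 -RintegralB//.
(* The maximum with 0 agrees almost everywhere with the difference and is nonnegative at every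
   point, as the positivity of the integral requires. *)
rewrite /Rintegral (ae_eq_integral (fun x => (Num.max 0 (g x - f x))%:E))//=.
- by apply: fine_ge0; apply: integral_ge0 => x _; rewrite lee_fin le_max lexx.
- exact: measurable_int (intbleB Ig If).
- apply/measurable_EFinP; apply: measurable_maxr => //.
  by apply/measurable_EFinP; exact: measurable_int (intbleB Ig If).
- apply: filterS fg => x fg _; congr _%:E.
  by rewrite max_r// subr_ge0.
Qed.

Lemma ae_eq_Rintegral f g : measurable_fun setT f -> measurable_fun setT g ->
  {ae mu, forall x, f x = g x} -> \int[mu]_x f x = \int[mu]_x g x.
Proof.
move=> mf mg fg; congr fine; apply: ae_eq_integral => //; [exact/measurable_EFinP..|].
by apply: filterS fg => x -> _.
Qed.

Lemma Rintegral_sqr_ge0 f : 0 <= \int[mu]_x (f x ^+ 2).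
Proof. by apply: Rintegral_ge0 => x _; rewrite sqr_ge0. Qed.

(** Stands in for the triangle inequality, so that L2 distances can be kept squared. The gap between
    the two sides is the integral of the square of [f - g]. *)
Lemma Rintegral_sqrD f g : f \in L2 -> g \in L2 ->
  \int[mu]_x ((f x + g x) ^+ 2) <= 2 * (\int[mu]_x (f x ^+ 2)) + 2 * (\int[mu]_x (g x ^+ 2)).
Proof.
move=> Lf Lg.
have If := L2_sqr_integrable Lf; have Ig := L2_sqr_integrable Lg.
rewrite -!RintegralZl// -RintegralD//; [|exact: intbleZ..].
apply: le_Rintegral => //; first exact: L2_sqr_integrable (L2D Lf Lg).
  by apply: intbleD; exact: intbleZ.
by move=> x _; rewrite -subr_ge0; have := sqr_ge0 (f x - g x); congr (_ <= _); ring.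
Qed.

(** A discriminant argument: the square of [f - t g] has nonnegative integral for every [t]. *)
Lemma cauchy_schwarz f g : f \in L2 -> g \in L2 ->
  (\int[mu]_x (f x * g x)) ^+ 2 <= (\int[mu]_x (f x ^+ 2)) * (\int[mu]_x (g x ^+ 2)).
Proof.
move=> Lf Lg.
have If := L2_sqr_integrable Lf; have Ig := L2_sqr_integrable Lg.
have Ifg := L2_mul_integrable Lf Lg.
set F := \int[mu]_x (f x ^+ 2); set G := \int[mu]_x (g x ^+ 2); set b := Rintegral _ _ _.
have F0 : 0 <= F by exact: Rintegral_sqr_ge0.
have G0 : 0 <= G by exact: Rintegral_sqr_ge0.
have H t : 0 <= F - 2 * t * b + t ^+ 2 * G.
  have := Rintegral_sqr_ge0 (fun x => f x - t * g x).
  rewrite (_ : Rintegral _ _ _ = F - 2 * t * b + t ^+ 2 * G)// /F /G /b.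
  rewrite -!RintegralZl// -RintegralB//; last exact: intbleZ.
  rewrite -RintegralD//; [|by apply: intbleB => //; exact: intbleZ|exact: intbleZ].
  by apply: eq_Rintegral => x _; ring.
have [G0'|Gn0] := eqVneq G 0.
  have [->|b0] := eqVneq b 0; first by rewrite expr0n /= mulr_ge0.
  (* The quadratic in [t] has degenerated to an affine function of nonzero slope; this [t] gives it
     the value -1. *)
  have := H ((F + 1) / (2 * b)); rewrite G0' mulr0 addr0.
  have -> : 2 * ((F + 1) / (2 * b)) * b = F + 1 by field.
  by lra.
have Gp : 0 < G by rewrite lt_neqAle eq_sym Gn0.
(* The minimizer of the quadratic. *)
have := H (b / G).
have -> : F - 2 * (b / G) * b + (b / G) ^+ 2 * G = F - b ^+ 2 / G by field.
by rewrite subr_ge0 ler_pdivrMr.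
Qed.

(** Integrability is bundled with convergence so that the limit of a compound integrand can be
    assembled along its syntax. *)
Definition cvgI (F_ : nat -> X -> R) (F : X -> R) :=
  [/\ forall n, intble (F_ n), intble F &
      \int[mu]_x F_ n x @[n --> \oo] --> \int[mu]_x F x].

Definition cvgL2 (F_ : nat -> X -> R) (F : X -> R) :=
  [/\ forall n, F_ n \in L2, F \in L2 &
      \int[mu]_x ((F_ n x - F x) ^+ 2) @[n --> \oo] --> (0 : R)].

Lemma cvgI_cst f : intble f -> cvgI (fun=> f) f.
Proof. by move=> If; split => //; exact: cvg_cst. Qed.

Lemma cvgID F_ F G_ G : cvgI F_ F -> cvgI G_ G ->
  cvgI (fun n x => F_ n x + G_ n x) (fun x => F x + G x).
Proof.
move=> [F1 F2 F3] [G1 G2 G3]; split; [by move=> n; exact: intbleD|exact: intbleD|].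
rewrite RintegralD//; under eq_cvg do rewrite RintegralD//.
exact: cvgD.
Qed.

Lemma cvgIZ (a_ : nat -> R) (a : R) F_ F : a_ n @[n --> \oo] --> a -> cvgI F_ F ->
  cvgI (fun n x => a_ n * F_ n x) (fun x => a * F x).
Proof.
move=> aa [F1 F2 F3]; split; [by move=> n; exact: intbleZ|exact: intbleZ|].
rewrite RintegralZl//; under eq_cvg do rewrite RintegralZl//.
exact: cvgM.
Qed.

Lemma cvgIN F_ F : cvgI F_ F -> cvgI (fun n x => - F_ n x) (fun x => - F x).
Proof.
move=> [F1 F2 F3]; split; [by move=> n; exact: intbleN|exact: intbleN|].
rewrite RintegralN//; under eq_cvg do rewrite RintegralN//.
exact: cvgN.
Qed.

Lemma cvgIB F_ F G_ G : cvgI F_ F -> cvgI G_ G ->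
  cvgI (fun n x => F_ n x - G_ n x) (fun x => F x - G x).
Proof. by move=> ? ?; exact/cvgID/cvgIN. Qed.

Lemma cvgI_sum (I : finType) (F_ : I -> nat -> X -> R) (F : I -> X -> R) :
  (forall i, cvgI (F_ i) (F i)) ->
  cvgI (fun n x => \sum_i F_ i n x) (fun x => \sum_i F i x).
Proof.
move=> H; have H1 i := (let: And3 p _ _ := H i in p).
have H2 i := (let: And3 _ p _ := H i in p).
split; [by move=> n; exact: intble_sum|exact: intble_sum|].
rewrite Rintegral_sum//; under eq_cvg do rewrite Rintegral_sum//.
by apply: cvg_big => [|i _]; [exact: add_continuous|case: (H i)].
Qed.

Lemma cvgL2_cst f : f \in L2 -> cvgL2 (fun=> f) f.
Proof.
move=> Lf; split => //; rewrite (_ : (fun n : nat => _) = fun=> 0); first exact: cvg_cst.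
apply/funext => n; rewrite -[RHS](mul0r (fine (mu setT))) -Rintegral_cst//.
by apply: eq_Rintegral => x _; rewrite subrr expr0n.
Qed.

Lemma cvgL2D F_ F G_ G : cvgL2 F_ F -> cvgL2 G_ G ->
  cvgL2 (fun n x => F_ n x + G_ n x) (fun x => F x + G x).
Proof.
move=> [F1 F2 F3] [G1 G2 G3]; split; [by move=> n; exact: L2D|exact: L2D|].
have := seq_cvgD (seq_cvgZ (c := 2) F3) (seq_cvgZ (c := 2) G3).
rewrite !mulr0 addr0 => H.
apply: (cvg_squeeze0 _ H) => n; rewrite Rintegral_sqr_ge0/=.
apply: le_trans (Rintegral_sqrD (L2B (F1 n) F2) (L2B (G1 n) G2)).
rewrite le_eqVlt; apply/orP; left; apply/eqP.
by apply: eq_Rintegral => x _; congr (_ ^+ 2); ring.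
Qed.

Lemma cvgL2_scal (a_ : nat -> R) (a : R) f : a_ n @[n --> \oo] --> a -> f \in L2 ->
  cvgL2 (fun n x => a_ n * f x) (fun x => a * f x).
Proof.
move=> aa Lf; split; [by move=> n; exact: L2Z|exact: L2Z|].
have H : (a_ n - a) ^+ 2 * \int[mu]_x (f x ^+ 2) @[n --> \oo] --> (0 : R).
  rewrite -[X in _ --> X](mul0r (\int[mu]_x (f x ^+ 2))); apply: cvgMl.
  rewrite -[X in _ --> X](mulr0 (0 : R)); under eq_cvg do rewrite expr2.
  by apply: cvgM; rewrite -(subrr a); apply: cvgB => //; exact: cvg_cst.
apply: (cvg_eqfun _ H) => n.
rewrite -RintegralZl//; last exact: L2_sqr_integrable.
by apply: eq_Rintegral => x _; ring.
Qed.

Lemma cvgL2Z a F_ F : cvgL2 F_ F -> cvgL2 (fun n x => a * F_ n x) (fun x => a * F x).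
Proof.
move=> [F1 F2 F3]; split; [by move=> n; exact: L2Z|exact: L2Z|].
have := seq_cvgZ (c := a ^+ 2) F3; rewrite mulr0 => H.
apply: (cvg_eqfun _ H) => n /=.
rewrite -RintegralZl//; last exact: L2_sqr_integrable (L2B (F1 n) F2).
by apply: eq_Rintegral => x _; ring.
Qed.

Lemma cvgL2N F_ F : cvgL2 F_ F -> cvgL2 (fun n x => - F_ n x) (fun x => - F x).
Proof.
move=> [F1 F2 F3]; split; [by move=> n; exact: L2N|exact: L2N|].
apply: (cvg_eqfun _ F3) => n /=.
by apply: eq_Rintegral => x _; ring.
Qed.

Lemma cvgL2B F_ F G_ G : cvgL2 F_ F -> cvgL2 G_ G ->
  cvgL2 (fun n x => F_ n x - G_ n x) (fun x => F x - G x).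
Proof. by move=> ? ?; exact/cvgL2D/cvgL2N. Qed.

Lemma cvg_sqr0 (u : nat -> R) : u n ^+ 2 @[n --> \oo] --> (0:R) -> u n @[n --> \oo] --> (0:R).
Proof.
move=> H; apply: norm_cvg0.
have -> : (fun n => `|u n|) = (fun n => Num.sqrt (u n ^+ 2)) by apply/funext => n; rewrite sqrtr_sqr.
rewrite -[X in _ --> X]sqrtr0.
exact: (continuous_cvg _ (@sqrt_continuous R _) H).
Qed.

(** [F_n G_n - F G] splits into (F_n - F)(G_n - G), (F_n - F) G and F (G_n - G); in each product one
    factor tends to 0 in L2 while the norm of the other converges. *)
Lemma cvgI_mul F_ F G_ G : cvgL2 F_ F -> cvgL2 G_ G ->
  cvgI (fun n x => F_ n x * G_ n x) (fun x => F x * G x).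
Proof.
move=> [F1 F2 F3] [G1 G2 G3].
split; [by move=> n; exact: L2_mul_integrable|exact: L2_mul_integrable|].
have key A_ B_ (a b : R) : (forall n, A_ n \in L2) -> (forall n, B_ n \in L2) ->
    \int[mu]_x (A_ n x ^+ 2) @[n --> \oo] --> (a:R) ->
    \int[mu]_x (B_ n x ^+ 2) @[n --> \oo] --> (b:R) -> a * b = 0 ->
    \int[mu]_x (A_ n x * B_ n x) @[n --> \oo] --> (0:R).
  move=> LA LB Aa Bb ab; apply: cvg_sqr0; have := seq_cvgM Aa Bb; rewrite ab => H.
  apply: (cvg_squeeze0 _ H) => n; rewrite sqr_ge0/=.
  exact: cauchy_schwarz.
have h1 := key _ _ _ _ (fun n => L2B (F1 n) F2) (fun n => L2B (G1 n) G2) F3 G3 (mul0r _).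
have h2 := key _ _ _ _ (fun n => L2B (F1 n) F2) (fun n => G2) F3 (@seq_cvg_cst R (\int[mu]_x (G x ^+ 2))) (mul0r _).
have h3 := key _ _ _ _ (fun n => F2) (fun n => L2B (G1 n) G2) (@seq_cvg_cst R (\int[mu]_x (F x ^+ 2))) G3 (mulr0 _).
have := seq_cvgD (seq_cvgD (seq_cvgD h1 h2) h3) (@seq_cvg_cst R (\int[mu]_x (F x * G x))).
rewrite !add0r; apply: cvg_eqfun => n /=.
have LFn := L2B (F1 n) F2; have LGn := L2B (G1 n) G2.
have i1 := L2_mul_integrable LFn LGn; have i2 := L2_mul_integrable LFn G2.
have i3 := L2_mul_integrable F2 LGn; have i4 := L2_mul_integrable F2 G2.

rewrite -RintegralD// -RintegralD//; last exact: intbleD.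
rewrite -RintegralD//; last by do 2 apply: intbleD => //.
by apply: eq_Rintegral => x _; ring.
Qed.

End square_integrable.

(** * The measure of the cube *)

Section cube.
Context {R : realType}.

Local Notation unif := (uniform_prob (@ltr01 R)).

Definition upd n (x : torus R n) (i : 'I_n) (s : R) : torus R n :=
  [tuple if j == i then s else tnth x j | j < n].

Lemma tnth_upd n (x : torus R n) i s j :
  tnth (upd x i s) j = if j == i then s else tnth x j.
Proof. by rewrite tnth_mktuple. Qed.

Lemma cube_cons0 n (p : spacetime R n) (s : R) :
  cube_cons (s, p.2) = upd (cube_cons p) ord0 s.
Proof.
apply: eq_from_tnth => j; rewrite tnth_upd.
case: (unliftP ord0 j) => [k ->|->]; last by rewrite eqxx /cube_cons tnth0.
by rewrite /cube_cons !tnthS eq_sym (negbTE (neq_lift _ _)).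
Qed.

Lemma cube_consS n (s : R) (x : torus R n) (i : 'I_n) (u : R) :
  cube_cons (s, upd x i u) = upd (cube_cons (s, x)) (lift ord0 i) u.
Proof.
apply: eq_from_tnth => j; rewrite tnth_upd.
case: (unliftP ord0 j) => [k ->|->]; last by rewrite /cube_cons !tnth0 (negbTE (neq_lift _ _)).
by rewrite /cube_cons !tnthS tnth_upd (inj_eq lift_inj).
Qed.

(** Fubini along the [i]-th coordinate. It is the device behind integration by parts on the torus:
    the integrand will be a derivative along coordinate lines of a periodic function. *)
Lemma cube_integral0 n (i : 'I_n) (h : torus R n -> R) :
  (cube_measure n).-integrable setT (EFin \o h) ->
  (forall x, (\int[unif]_s (h (upd x i s))%:E = 0)%E) ->
  (\int[cube_measure n]_x (h x)%:E = 0)%E.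
Proof.
elim: n i h => [[]//|n IH] i h ih h0.
have mh : measurable_fun setT h by apply/measurable_EFinP; exact: measurable_int ih.
pose f := (EFin \o h) \o @cube_cons R n.
have mf : measurable_fun setT f.
  by apply: measurableT_comp; [exact/measurable_EFinP|exact: measurable_cube_cons].
have If : (unif \x cube_measure n)%E.-integrable setT f.
  apply/integrableP; split => //.
  case/integrableP : ih => _; apply: le_lt_trans.
  rewrite /= (@ge0_integral_distribution _ _ _ _ _ _ _ (abse \o EFin \o h))//.
  - by apply: measurableT_comp => //; exact/measurable_EFinP.
  - by move=> y; exact: abse_ge0.
transitivity (\int[unif \x cube_measure n]_p f p)%E.
  by apply: integral_distribution => //; exact/measurable_EFinP.
case: (unliftP ord0 i) => [j|] ij.
  rewrite -integral12_prod_meas1// /fubini_F.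
  rewrite (ae_eq_integral (cst 0%E)) ?integral_cst ?mul0e//.
    by have /integrableP[] := integrable_fubini_F If.
  (* The induction hypothesis needs an integrable slice, which almost every value of the first
     coordinate provides. *)
  apply: filterS (ae_integrable1 If) => s Is _ /=.
  apply: (IH j (fun x => h (cube_cons (s, x)))) => // x.
  rewrite -[RHS](h0 (cube_cons (s, x))); apply: eq_integral => u _.
  by rewrite cube_consS ij.
(* Here [i] is the first coordinate: with the other order of integration, the inner integral is the
   one assumed to vanish. *)
rewrite -integral21_prod_meas1// /fubini_G.
apply: integral0_eq => x _; rewrite -[RHS](h0 (cube_cons (0, x))).
by apply: eq_integral => u _; rewrite ij -cube_cons0.
Qed.

Lemma cube_measure_tnth n (i : 'I_n) (A : set R) : measurable A ->
  cube_measure n [set x | A (tnth x i)] = unif A.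
Proof.
move=> mA; elim: n i => [[]//|n IH] i.
rewrite /= /distribution /pushforward.
case: (unliftP ord0 i) => [j|] ->.
  rewrite (_ : _ @^-1` _ = setT `*` [set x | A (tnth x j)]); last first.
    by apply/seteqP; split => [[s x]|[s x] []] /=; rewrite /cube_cons tnthS.
  rewrite product_measure1E//; last first.
    by rewrite -[X in measurable X]setTI; exact: measurable_tnth.
  by rewrite [X in (X * _)%E](probability_setT unif) mul1e; exact: IH.
rewrite (_ : _ @^-1` _ = A `*` setT); last first.
  by apply/seteqP; split => [[s x]|[s x] []] /=; rewrite /cube_cons tnth0.
by rewrite product_measure1E// [X in (_ * X)%E]probability_setT mule1.
Qed.

(** Excluding the endpoints matters later: the periodic approximations of a ray vanish at 0 and 1,
    so they can converge to its indicator only inside the interval. *)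
Lemma ae_unif_itv : {ae unif, forall s, 0 < s < 1}.
Proof.
have s1 (x : R) : unif.-negligible [set x].
  apply/negligibleP => //; have /null_content_dominatesP D := @dominates_uniform_prob R 0 1 ltr01.
  by apply: D => //; exact: lebesgue_measure_set1.
have s2 : unif.-negligible (~` `[0, 1]%classic).
  apply/negligibleP; first exact: measurableC.
  apply: etrans; first by apply: (probability_setC unif); exact: measurable_itv.
  rewrite [X in (_ - X)%E](_ : _ = 1%E) ?subee//.
  by apply: (integral_uniform_pdf1 ltr01); exact: subset_refl.
apply: negligibleS (negligibleU (negligibleU s2 (s1 0)) (s1 1)).
move=> s /= H; apply: contrapT => K; apply: H.
rewrite lt_neqAle [s < 1]lt_neqAle.
have [/andP[s0 s1']|] := boolP (0 <= s <= 1); last first.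
  by move=> /negP s01; exfalso; apply: K; left; left => /=; rewrite in_itv.
rewrite s0 s1' !andbT; apply/andP; split; apply/eqP => e; apply: K; [left; right|right] => //.
Qed.

Lemma unif_integral_derive (F f : R -> R) :
  (forall s : R, is_derive s (1 : R) F (f s)) -> continuous f -> F 0 = F 1 ->
  (\int[unif]_s (f s)%:E = 0)%E.
Proof.
move=> dF cf F01.
have mf : measurable_fun setT f by exact: continuous_measurable_fun.
have mEf : measurable_fun setT (EFin \o f) by exact/measurable_EFinP.
rewrite integralE !integral_uniform//; [|exact: measurable_funeneg|exact: measurable_funepos].
rewrite subr0 invr1 !mul1e -integralE.
have cF s : {for s, continuous F}.
  by apply: differentiable_continuous; apply/derivable1_diffP; exact: (@ex_derive _ _ _ _ _ _ _ (dF s)).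
have dvF s : derivable F s 1 := @ex_derive _ _ _ _ _ _ _ (dF s).
rewrite (@continuous_FTC2 _ f F)//.
- by rewrite F01 subee.
- exact: continuous_subspaceT.
- split => //.
  + exact: cvg_at_right_filter (cF 0).
  + exact: cvg_at_left_filter (cF 1).
- by move=> s _; rewrite derive1E; exact: (@derive_val _ _ _ _ _ _ _ (dF s)).
Qed.

Section on_spacetime.
Variables (T : R) (d : nat).
Local Notation mu := (spacetime_measure T d).

Lemma spacetime_measure_lty : (mu setT < +oo)%E.
Proof.
rewrite (_ : mu setT = time_measure T setT * cube_measure d setT)%E; last first.
  by rewrite -setXTT; exact: product_measure1E.
rewrite probability_setT mule1.
exact: (fin_num_fun_lty (@fin_num_measure _ _ _ (time_measure T))).
Qed.

Lemma ae_time : {ae mu, forall q, 0 <= q.1 <= T}.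
Proof.
exists ((~` `[0, T]%classic) `*` setT); split.
- by apply: measurableX => //; exact: measurableC.
- apply: etrans; first by apply: product_measure1E => //; exact: measurableC.
  apply: etrans (mul0e (cube_measure d setT)); congr (_ * _)%E.
  by rewrite /= /mfrestr /mrestr setICl measure0.
- by move=> q /= H; split => //=; rewrite in_itv.
Qed.

Lemma ae_tnth (P : R -> Prop) (i : 'I_d) :
  {ae unif, forall s, P s} -> {ae mu, forall q, P (tnth q.2 i)}.
Proof.
move=> [A [mA A0 PA]]; exists (setT `*` [set x | A (tnth x i)]).
have mA' : measurable [set x : torus R d | A (tnth x i)].
  by rewrite -[X in measurable X]setTI; exact: measurable_tnth.
split; first exact: measurableX.
- apply: etrans; first exact: product_measure1E.
  by rewrite [X in (_ * X)%E](cube_measure_tnth i mA) A0 mule0.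
- by move=> q H; split => //=; exact: PA.
Qed.

Lemma ae_cube : {ae mu, forall q, forall i : 'I_d, 0 < tnth q.2 i < 1}.
Proof.
by apply: filter_forall => i; exact: (ae_tnth (P := fun s => 0 < s < 1) i ae_unif_itv).
Qed.

Lemma spacetime_integral0 (i : 'I_d) (h : spacetime R d -> R) :
  mu.-integrable setT (EFin \o h) ->
  (forall q, (\int[unif]_s (h (q.1, upd q.2 i s))%:E = 0)%E) ->
  \int[mu]_q (h q) = 0.
Proof.
move=> ih h0; rewrite /Rintegral -integral12_prod_meas1// /fubini_F.
rewrite (ae_eq_integral (cst 0%E)) ?integral_cst ?mul0e//.
  by have /integrableP[] := integrable_fubini_F ih.
apply: filterS (ae_integrable1 ih) => t It _ /=.
by apply: (cube_integral0 (i := i) It) => x; exact: (h0 (t, x)).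
Qed.

Lemma L2_snd (f : torus R d -> R) : f \in Lfun (cube_measure d) 2%:E ->
  (fun q : spacetime R d => f q.2) \in Lfun mu 2%:E.
Proof.
move=> /L2P[mf fy]; apply/L2P; split; first exact: measurableT_comp.
rewrite /= fubini_tonelli1//=; last 2 first.
- by apply/measurable_EFinP; apply: measurable_funX; exact: measurableT_comp.
- by move=> x; rewrite lee_fin sqr_ge0.
rewrite /fubini_F -/(cst (\int[cube_measure d]_y ((f y) ^+ 2)%:E)%E) integral_cst// lte_mul_pinfty//.
- by apply: integral_ge0 => x _; rewrite lee_fin sqr_ge0.
- by rewrite ge0_fin_numE//; apply: integral_ge0 => x _; rewrite lee_fin sqr_ge0.
- exact: (fin_num_fun_lty (@fin_num_measure _ _ _ (time_measure T))).
Qed.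

End on_spacetime.
End cube.

(** * Continuous and smooth periodic fields *)

Section continuous_fields.
Context {R : realType} {d : nat}.
Local Notation unif := (uniform_prob (@ltr01 R)).

Definition unit_cube : set 'rV[R]_d := [set y | forall i, y ord0 i \in `[0, 1]].

Lemma slab_bounded (T : R) (f : R * 'rV[R]_d -> R) :
  {within slab T, continuous f} ->
  exists C, forall p, 0 <= p.1 <= T -> unit_cube p.2 -> `|f p| <= C.
Proof.
move=> cf; pose K : set (R * 'rV[R]_d) := `[0, T]%classic `*` unit_cube.
have cK : compact K.
  by apply: compact_setX; [exact: segment_compact|exact: (rV_compact (fun=> @segment_compact R 0 1))].
have cfK : {within K, continuous f}.
  by apply: continuous_subspaceW cf => p [] /=; rewrite in_itv.
have [M [_ HM]] := compact_bounded (continuous_compact cfK cK).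
exists (M + 1) => p p1 p2; apply: (HM (M + 1)); first by rewrite ltrDl.
by exists p => //; split => //=; rewrite in_itv.
Qed.

Lemma rV_rat_box (p : R * 'rV[R]_d) (e : R) : 0 < e ->
  exists (c : rat * {ffun 'I_d -> rat}) (k : nat),
    [/\ (k.+1%:R)^-1 < e, `|ratr c.1 - p.1| < (k.+1%:R)^-1 &
        forall i, `|ratr (c.2 i) - p.2 ord0 i| < (k.+1%:R)^-1].
Proof.
move=> e0.
have [k ke] : exists k : nat, (k.+1%:R)^-1 < e.
  have [N _ H] : \forall n \near \oo, harmonic n < e :> R.
    exact: (cvgr_lt _ cvg_harmonic).
  by exists N; apply: H => /=.
have near_rat (x : R) : exists q : rat, `|ratr q - x| < (k.+1%:R)^-1.
  have : x - (k.+1%:R)^-1 < x + (k.+1%:R)^-1 by rewrite ltrBlDr -addrA ltrDl addr_gt0// invr_gt0.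
  move=> /rat_in_itvoo[q]; rewrite in_itv/= => q1; exists q.
  by rewrite ltr_distl.
have [q1 Hq1] := near_rat p.1.
have /choice[q2 Hq2] : forall i, exists q : rat, `|ratr q - p.2 ord0 i| < (k.+1%:R)^-1.
  by move=> i; exact: near_rat.
by exists (q1, [ffun i => q2 i]), k; split => // i; rewrite ffunE.
Qed.

(** Continuity refers to the topology of [R * 'rV[R]_d], measurability to the product sigma-algebra
    on tuples. They meet in boxes with rational centres, of which there are countably many and which
    are measurable for the latter. *)
Lemma measurable_fun_point_of (f : R * 'rV[R]_d -> R) : continuous f ->
  measurable_fun setT (fun q : spacetime R d => f (point_of q)).
Proof.
move=> cf; apply: (measurability _ (RGenOInfty.measurableE R)) => /= _ [_ [a ->] <-]; rewrite setTI.
set U := `]a, +oo[%classic.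
have oU : open U by exact: interval_open.
have oV : open (f @^-1` U) by apply: open_comp => // p _; exact: cf.
pose box (c : (rat * {ffun 'I_d -> rat}) * nat) : set (spacetime R d) :=
  [set q | `|ratr c.1.1 - q.1| < (c.2.+1%:R)^-1 /\
     forall i, `|ratr (c.1.2 i) - tnth q.2 i| < (c.2.+1%:R)^-1].
have mbox c : measurable (box c).
  rewrite /box (_ : [set q | _] =
     (fst @^-1` [set x | `|ratr c.1.1 - x| < (c.2.+1%:R)^-1]) `&`
     \bigcap_(i in [set: 'I_d]) ((fun q : spacetime R d => tnth q.2 i) @^-1`
         [set x | `|ratr (c.1.2 i) - x| < (c.2.+1%:R)^-1])); last first.
    by apply/seteqP; split => q [q1 q2]; split => // i; [move=> _|]; exact: q2.
  have mball u v : measurable [set x : measurableTypeR R | `|u - x| < v].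
    rewrite (_ : [set _ | _] = (ball u v)) //; exact: measurable_ball.
  apply: measurableI.
    by rewrite -[X in measurable X]setTI; exact: measurable_fst.
  apply: fin_bigcap_measurable => // i _.
  rewrite -[X in measurable X]setTI.
  have : measurable_fun setT (fun q : spacetime R d => tnth q.2 i).
    by apply: (measurableT_comp (measurable_tnth i)); exact: measurable_snd.
  by apply.
(* The preimage of [U] is the union of the boxes whose points are all sent into [U]. *)
pose good (c : (rat * {ffun 'I_d -> rat}) * nat) :=
  forall q, box c q -> U (f (point_of q)).
rewrite (_ : _ @^-1` _ = \bigcup_c (if `[< good c >] then box c else set0)).
  apply: countable_bigcupT_measurable; first exact: countableP.
  by move=> c; case: ifPn.
apply/seteqP; split => [q /= Uq|q [c _]]; last by case: asboolP => // H /H.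
have /nbhs_ballP[e /= e0 He] : nbhs (point_of q) (f @^-1` U) by exact: open_nbhs_nbhs.
(* The radius stays below e/2 because two points of a box are compared through its centre. *)
have [c [k [ke H1 H2]]] := rV_rat_box (point_of q) (divr_gt0 e0 (ltr0Sn _ 1)).
exists (c, k) => //; case: asboolP => [_|[]].
  by split => //= i; have := H2 i; rewrite mxE.
move=> q' [/= K1 K2]; apply: He; split => /=.
  rewrite -ball_normE /=; apply: le_lt_trans (ler_distD (ratr c.1) _ _) _.
  rewrite [e]splitr distrC ltrD ?(lt_trans K1)//.
  by rewrite (lt_trans H1).
split => // z i; rewrite !mxE -ball_normE /=.
apply: le_lt_trans (ler_distD (ratr (c.2 i)) _ _) _.
rewrite [e]splitr ltrD ?(lt_trans (K2 i))// distrC.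
by have := H2 i; rewrite mxE => /lt_trans; exact.
Qed.

Definition testfun (phi : R * 'rV[R]_d -> R) := smooth phi /\ periodic_in_space phi.

Lemma smooth_continuous (V : normedModType R) (f : V -> R) : smooth f -> continuous f.
Proof. by move=> /(_ 0%N). Qed.

Lemma smooth_differentiable (V : normedModType R) (f : V -> R) x : smooth f -> differentiable f x.
Proof. by move=> /(_ 1%N) []. Qed.

Lemma smooth_derive (V : normedModType R) (f : V -> R) v : smooth f -> smooth ('D_v f).
Proof. by move=> sf n; have [_ ] := sf n.+1; exact. Qed.

Lemma smooth_cst (V : normedModType R) (c : R) : smooth (fun _ : V => c).
Proof.
move=> n; elim: n c => [c|n IH c] /=; first exact: cst_continuous.
split => [x|v]; first exact: differentiable_cst.
rewrite (_ : 'D_v _ = fun _ => 0) ; first exact: IH.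
by apply/funext => x; rewrite (derive_cst c).
Qed.

Lemma testfun_derive phi v : testfun phi -> testfun ('D_v phi).
Proof.
move=> [sp pp]; split; first exact: smooth_derive.
case: v => v1 v2 t x i; rewrite /derive; set f := fun h => _; set g := fun h => _.
rewrite (_ : f = g)//; apply/funext => h; rewrite /f /g /= pp; congr (_ *: (_ - _)).
have E y : h *: (v1, v2) + (t, y) = (h *: v1 + t, h *: v2 + y) by [].
by rewrite !E addrA pp.
Qed.

Lemma testfun_dx phi l : testfun phi -> testfun (dx l phi).
Proof. exact: testfun_derive. Qed.

Lemma testfun_dt phi : testfun phi -> testfun (dt phi).
Proof. exact: testfun_derive. Qed.

Lemma testfun0 : testfun (fun=> 0).
Proof. by split => //; exact: smooth_cst. Qed.

(** Smoothness and periodicity are part of what [xget] selects, and its default value 0 is a test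
    function too. *)
Lemma inv_laplacian_testfun f : testfun (inv_laplacian f).
Proof.
rewrite /inv_laplacian; case: xgetP => [g _ [sg pg _ _]//|_]; exact: testfun0.
Qed.

Lemma testfun_measurable phi : testfun phi ->
  measurable_fun setT (fun q : spacetime R d => phi (point_of q)).
Proof. by move=> [sp _]; apply: measurable_fun_point_of; exact: smooth_continuous. Qed.

Lemma ae_unit_cube T : {ae spacetime_measure T d, forall q : spacetime R d,
  0 <= q.1 <= T /\ unit_cube (row_of q.2)}.
Proof.
have FF := ae_filter_ringOfSetsType (spacetime_measure T d).
apply: filterS (filterI (ae_time T d) (ae_cube T d)) => q [q1 q2]; split => // i.
by rewrite mxE in_itv/=; have /andP[/ltW-> /ltW->] := q2 i.
Qed.

Lemma ae_bounded_slab (T : R) (f : R * 'rV[R]_d -> R) :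
  {within slab T, continuous f} ->
  exists C, {ae spacetime_measure T d, forall q, `|f (point_of q)| <= C}.
Proof.
move=> /slab_bounded[C HC]; exists C; apply: filterS (ae_unit_cube T) => q [q1 q2].
exact: HC.
Qed.

Lemma testfun_bounded (T : R) phi : testfun phi ->
  exists C, {ae spacetime_measure T d, forall q, `|phi (point_of q)| <= C}.
Proof.
by move=> [/smooth_continuous cp _]; apply: ae_bounded_slab; exact: continuous_subspaceT.
Qed.

Lemma row_of_upd (x : torus R d) (l : 'I_d) (s : R) :
  row_of (upd x l s) = row_of (upd x l 0) + s *: delta_mx 0 l.
Proof.
apply/rowP => j; rewrite !mxE !tnth_upd eqxx.
by case: eqVneq => [_|_] /=; rewrite ?mulr1 ?mulr0 ?add0r ?addr0.
Qed.

(** On a coordinate line [dx] is an ordinary derivative, and coordinates 0 and 1 differ by one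
    period: these are the hypotheses of [unif_integral_derive]. *)
Lemma testfun_line phi (l : 'I_d) (t : R) (x : torus R d) : testfun phi ->
  [/\ forall s : R, is_derive s (1 : R) (fun s => phi (t, row_of (upd x l s)))
                   (dx l phi (t, row_of (upd x l s))),
      continuous (fun s : R => phi (t, row_of (upd x l s))) &
      phi (t, row_of (upd x l 0)) = phi (t, row_of (upd x l 1))].
Proof.
move=> [sp pp]; split.
- move=> s; have := diff_derivable (v := ((0 : R), (delta_mx 0 l : 'rV[R]_d))) (smooth_differentiable (t, row_of (upd x l s)) sp).
  have E : (fun h : R => h^-1 *: ((phi \o shift (t, row_of (upd x l s))) (h *: (0, delta_mx 0 l))
              - phi (t, row_of (upd x l s)))) =
      (fun h : R => h^-1 *: (((fun s => phi (t, row_of (upd x l s))) \o shift s) (h *: (1 : R))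
              - phi (t, row_of (upd x l s)))).
    apply/funext => h /=; congr (_ *: (phi _ - _)); congr (_, _) => /=.
      by rewrite scaler0 add0r.
    rewrite [in LHS]row_of_upd [in RHS]row_of_upd addrCA -scalerDl.
    by congr (_ + _ *: _); rewrite /GRing.scale /= mulr1.
  move=> H; split; first by move: H; rewrite /derivable E.
  by rewrite /dx /derive E.
- move=> s; have H : row_of (upd x l u) @[u --> s] --> row_of (upd x l s).
    rewrite [X in _ --> X]row_of_upd.
    rewrite (_ : (fun s => row_of _) = (fun s : R => row_of (upd x l 0) + s *: delta_mx 0 l)); last first.
      by apply/funext => u; exact: row_of_upd.
    by apply: cvgD; [exact: cvg_cst|apply: cvgZr_tmp; exact: cvg_id].
  have := @cvg_pair _ _ _ (nbhs s) _ _ _ _ _ (fun=> t) (fun u => row_of (upd x l u)) (cvg_cst t) H.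
  move=> K; have Cp : phi p @[p --> (t, row_of (upd x l s))] --> phi (t, row_of (upd x l s)) by exact: smooth_continuous.
  exact: (@cvg_comp _ _ _ (fun u => (t, row_of (upd x l u))) phi _ _ _ (K _ _ _ _) Cp).
- by rewrite [in RHS]row_of_upd scale1r pp.
Qed.

End continuous_fields.

(** * Density of weakly differentiable functions *)

Section C1.
Context {R : realType}.
Implicit Types f g : R -> R.

Definition C1 f := exists2 f' : R -> R, continuous f' &
  forall x : R, is_derive x (1 : R) f (f' x).

Lemma is_derive_continuous f (x df : R) : is_derive x (1 : R) f df -> {for x, continuous f}.
Proof.
move=> H; apply: differentiable_continuous; apply/derivable1_diffP.
exact: (@ex_derive _ _ _ _ _ _ _ H).
Qed.

Lemma C1_continuous f : C1 f -> continuous f.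
Proof. by move=> [f' _ df] x; exact: is_derive_continuous (df x). Qed.

Lemma C1_cst c : C1 (fun=> c).
Proof. by exists (fun=> 0); [exact: cst_continuous|move=> x; exact: is_derive_cst]. Qed.

Lemma C1_id : C1 (fun x => x).
Proof. by exists (fun=> 1); [exact: cst_continuous|move=> x; exact: is_derive_id]. Qed.

Lemma C1_add f g : C1 f -> C1 g -> C1 (fun x => f x + g x).
Proof.
move=> [f' cf df] [g' cg dg]; exists (fun x => f' x + g' x).
  by move=> x; apply: cvgD; [exact: cf|exact: cg].
by move=> x; exact: (is_deriveD (df x) (dg x)).
Qed.

Lemma C1_mul f g : C1 f -> C1 g -> C1 (fun x => f x * g x).
Proof.
move=> Cf Cg; have cf := C1_continuous Cf; have cg := C1_continuous Cg.
case: Cf Cg => [f' cf' df] [g' cg' dg]; exists (fun x => f x * g' x + g x * f' x).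
  by move=> x; apply: cvgD; apply: cvgM; [exact: cf|exact: cg'|exact: cg|exact: cf'].
by move=> x; exact: (is_deriveM (df x) (dg x)).
Qed.

Lemma C1_expR f : C1 f -> C1 (fun x => expR (f x)).
Proof.
move=> Cf; have cf := C1_continuous Cf; case: Cf => f' cf' df.
have ce : continuous (fun x => expR (f x)).
  by move=> x; apply: continuous_comp; [exact: cf|exact: continuous_expR].
exists (fun x => expR (f x) * f' x).
  by move=> x; apply: cvgM; [exact: ce|exact: cf'].
by move=> x; exact: (@is_derive1_comp _ expR f x _ _ (is_derive_expR (f x)) (df x)).
Qed.

Lemma C1_opp f : C1 f -> C1 (fun x => - f x).
Proof.
move=> /(C1_mul (C1_cst (-1))); congr C1.
by apply/funext => x; rewrite mulN1r.
Qed.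

(* Vanishing at both ends of [0, 1] makes the function periodic; the shift by [n]
   in the exponent makes the limit at [x = a] equal to 0. *)
Definition ray_approx (a : R) (n : nat) (x : R) : R :=
  (1 - expR (- (n%:R ^+ 2 * (x * (1 - x)) ^+ 2))) *
  expR (- expR (n%:R - n%:R ^+ 2 * (x - a))).

Lemma C1_ray_approx a n : C1 (ray_approx a n).
Proof.
have Cs : C1 (fun x => x * (1 - x)).
  by apply: C1_mul; [exact: C1_id|apply: C1_add; [exact: C1_cst|apply: C1_opp; exact: C1_id]].
apply: C1_mul.
  apply: C1_add; first exact: C1_cst.
  apply: C1_opp; apply: C1_expR; apply: C1_opp.
  by apply: C1_mul; [exact: C1_cst|under eq_fun do rewrite expr2; exact: C1_mul].
apply: C1_expR; apply: C1_opp; apply: C1_expR; apply: C1_add; first exact: C1_cst.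
apply: C1_opp; apply: C1_mul; first exact: C1_cst.
by apply: C1_add; [exact: C1_id|exact: C1_cst].
Qed.

Lemma ray_approx_ge0_le1 a n x : 0 <= ray_approx a n x <= 1.
Proof.
have e1 (y : R) : y <= 0 -> 0 <= expR y <= 1.
  by move=> y0; rewrite expR_ge0 -expR0 ler_expR.
have /andP[p0 p1] : 0 <= expR (- (n%:R ^+ 2 * (x * (1 - x)) ^+ 2)) <= 1.
  by apply: e1; rewrite oppr_le0 mulr_ge0 ?sqr_ge0.
have /andP[q0 q1] : 0 <= expR (- expR (n%:R - n%:R ^+ 2 * (x - a))) <= 1.
  by apply: e1; rewrite oppr_le0 expR_ge0.
rewrite /ray_approx; apply/andP; split; first by rewrite mulr_ge0 ?subr_ge0.
by rewrite mulr_ile1 ?subr_ge0// lerBlDr lerDl.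
Qed.

Lemma ray_approx0 a n : ray_approx a n 0 = 0.
Proof. by rewrite /ray_approx mul0r expr0n mulr0 oppr0 expR0 subrr mul0r. Qed.

Lemma ray_approx1 a n : ray_approx a n 1 = 0.
Proof. by rewrite /ray_approx subrr mulr0 expr0n mulr0 oppr0 expR0 subrr mul0r. Qed.

Lemma cvg_expR0 (y : nat -> R) : (\forall n \near \oo, y n <= - n%:R) ->
  expR (y n) @[n --> \oo] --> (0 : R).
Proof.
move=> H; apply: (squeeze_cvgr (f := fun=> 0) (h := @harmonic R)); last exact: cvg_harmonic.
  near=> n; rewrite expR_ge0/=; apply: (@le_trans _ _ (expR (- n%:R))).
    by rewrite ler_expR; near: n.
  rewrite expRN /harmonic lef_pV2 ?posrE ?expR_gt0// ?ltr0Sn//.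
  by rewrite (le_trans _ (expR_ge1Dx _))// -natr1 addrC.
exact: cvg_cst.
Unshelve. all: by end_near. Qed.

Lemma near_nat_ge (x : R) : \forall n \near \oo, x <= n%:R.
Proof.
exists (Num.truncn `|x|).+1 => // n /= H.
rewrite (le_trans (ler_norm x))// ltW// (lt_le_trans (truncnS_gt _))// ler_nat//.
Qed.

Lemma cvg_ray_approx a x : 0 < x < 1 ->
  ray_approx a n x @[n --> \oo] --> (\1_[set y | a < y] x : R).
Proof.
move=> /andP[x0 x1].
have c0 : 0 < x * (1 - x) by rewrite mulr_gt0// subr_gt0.
(* Inside the unit interval x (1 - x) is positive, so the factor that enforces periodicity tends to
   1. *)
have H1 : 1 - expR (- (n%:R ^+ 2 * (x * (1 - x)) ^+ 2)) @[n --> \oo] --> 1 - (0 : R).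
  apply: cvgB; first exact: cvg_cst.
  apply: cvg_expR0; near=> n; rewrite lerN2.
  have : ((x * (1 - x)) ^+ 2)^-1 <= n%:R by near: n; exact: near_nat_ge.
  rewrite -[_^-1]mul1r ler_pdivrMr ?exprn_gt0// => K.
  by rewrite expr2 -mulrA ler_peMr.
suff H2 : expR (- expR (n%:R - n%:R ^+ 2 * (x - a))) @[n --> \oo] --> (\1_[set y | a < y] x : R).
  by have := seq_cvgM H1 H2; rewrite subr0 mul1r.
rewrite indicE; case: (ltP a x) => ax.
  (* Beyond [a] the quadratic term outweighs the shift: the inner exponential tends to 0, hence the
     outer one to 1. *)
  rewrite mem_set//= -[X in _ --> X]expR0 -[in X in _ --> X]oppr0.
  have H3 : - expR (n%:R - n%:R ^+ 2 * (x - a)) @[n --> \oo] --> - (0:R).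
    apply: cvgN; apply: cvg_expR0; near=> n.
    have : 2 / (x - a) <= n%:R by near: n; exact: near_nat_ge.
    rewrite ler_pdivrMr ?subr_gt0// => K.
    suff : n%:R * 2 <= n%:R ^+ 2 * (x - a) by lra.
    by rewrite expr2 -mulrA ler_wpM2l.
  exact: (continuous_cvg _ (@continuous_expR R _) H3).
(* Up to and including [a] the inner exponent is at least [n], so the outer exponential is at most
   exp(-n). *)
rewrite memNset/=; last by apply/negP; rewrite -leNgt.
apply: cvg_expR0; near=> n; rewrite lerN2 (le_trans _ (expR_ge1Dx _))//.
have : 0 <= n%:R ^+ 2 * (a - x) by rewrite mulr_ge0 ?sqr_ge0// subr_ge0.
by lra.
Unshelve. all: by end_near. Qed.

End C1.

Section dominated.
Context {R : realType} {disp : measure_display} {X : measurableType disp}.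
Variable mu : {measure set X -> \bar R}.

Lemma cvgL2_dominated (F_ : nat -> X -> R) (F H : X -> R) :
  (forall n, F_ n \in Lfun mu 2%:E) -> F \in Lfun mu 2%:E -> H \in Lfun mu 2%:E ->
  {ae mu, forall x, F_ n x @[n --> \oo] --> F x} ->
  (forall n, {ae mu, forall x, `|F_ n x| <= H x}) -> {ae mu, forall x, `|F x| <= H x} ->
  cvgL2 mu F_ F.
Proof.
move=> LF_ LF LH cF FH_ FH; split => //.
pose f_ n x := ((F_ n x - F x) ^+ 2)%:E.
(* Where both [F_ n] and [F] are bounded by [H], their difference is at most [2 H]. *)
pose g x := (4 * H x ^+ 2)%:E.
have mf n : measurable_fun setT (f_ n).
  by apply/measurable_EFinP; have /L2P[] := L2B (LF_ n) LF; move=> + _; exact: measurable_funX.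
have [|||||_ _ h] := @dominated_convergence _ _ _ mu setT measurableT f_ (cst 0%E) g.
- exact: mf.
- exact: measurable_cst.
- apply: filterS cF => x cFx _; rewrite /f_.
  apply: cvg_EFin; first exact: nearW.
  have c0 : F_ n x - F x @[n --> \oo] --> (0 : R).
    by rewrite -(subrr (F x)); apply: cvgB => //; exact: cvg_cst.
  by have := seq_cvgM c0 c0; rewrite mulr0.
- by apply: (intbleZ 4); exact: L2_sqr_integrable.
- have /ae_foralln h := FH_.
  apply: filterS (filterI h FH) => x [hx Fx] n _.
  rewrite /f_ /g abse_EFin lee_fin ger0_norm ?sqr_ge0//.
  rewrite (_ : 4 * H x ^+ 2 = (2 * H x) ^+ 2); last by ring.
  rewrite -[leLHS]real_normK ?num_real// ler_sqr ?nnegrE//.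
    rewrite (le_trans (ler_normB _ _))//; have := hx n; lra.
  by rewrite mulr_ge0// (le_trans _ Fx).
rewrite integral_cst// mul0e in h.
have -> : (fun n => \int[mu]_x (F_ n x - F x) ^+ 2) = (fun n => fine (\int[mu]_x f_ n x)%E) by [].
exact: (fine_cvg h).
Qed.

End dominated.

(** * Weak space derivatives and the density argument *)

Section density.
Import HBNNSimple.
Context {R : realType} {d : nat}.
Variable T : R.
Local Notation mu := (spacetime_measure T d).
Local Notation L2 := (Lfun mu 2%:E).
Local Notation unif := (uniform_prob (@ltr01 R)).
Implicit Types (w g F : spacetime R d -> R).

Definition weak_dx (l : 'I_d) w g := forall phi : R * 'rV[R]_d -> R, testfun phi ->
  \int[mu]_q (g q * phi (point_of q)) = - \int[mu]_q (w q * dx l phi (point_of q)).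

(** Only space derivatives are asked for, since the viscous terms differentiate in space alone. Time
    may thus be cut off by arbitrary measurable sets. *)
Definition weakly_diff w := w \in L2 /\ forall l, exists2 g, g \in L2 & weak_dx l w g.

Lemma L2_testfun f (phi : R * 'rV[R]_d -> R) : f \in L2 -> testfun phi ->
  (fun q => f q * phi (point_of q)) \in L2.
Proof.
move=> Lf tp; have [C HC] := testfun_bounded T tp.
exact: (L2_mulb Lf (testfun_measurable tp) HC).
Qed.

Lemma L2_intble f : f \in L2 -> mu.-integrable setT (EFin \o f).
Proof.
move=> Lf; have := L2_mul_integrable Lf (L2_cst (spacetime_measure_lty T d) 1).
by apply: intble_eq => x; rewrite mulr1.
Qed.

Lemma weak_dxD l w g w' g' : w \in L2 -> g \in L2 -> w' \in L2 -> g' \in L2 ->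
  weak_dx l w g -> weak_dx l w' g' ->
  weak_dx l (fun q => w q + w' q) (fun q => g q + g' q).
Proof.
move=> Lw Lg Lw' Lg' H H' phi tp; have tdp := testfun_dx l tp.
under eq_Rintegral do rewrite mulrDl.
rewrite RintegralD//; [|exact: L2_intble (L2_testfun _ _)..].
under [in RHS]eq_Rintegral do rewrite mulrDl.
rewrite [in RHS]RintegralD//; [|exact: L2_intble (L2_testfun _ _)..].
by rewrite opprD H// H'.
Qed.

Lemma weak_dxZ l c w g : w \in L2 -> g \in L2 ->
  weak_dx l w g -> weak_dx l (fun q => c * w q) (fun q => c * g q).
Proof.
move=> Lw Lg H phi tp; have tdp := testfun_dx l tp.
under eq_Rintegral do rewrite -mulrA.
rewrite RintegralZl//; last exact: L2_intble (L2_testfun _ _).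
under [in RHS]eq_Rintegral do rewrite -mulrA.
rewrite [in RHS]RintegralZl//; last exact: L2_intble (L2_testfun _ _).
by rewrite H// mulrN.
Qed.

Lemma weakly_diffD w w' : weakly_diff w -> weakly_diff w' -> weakly_diff (fun q => w q + w' q).
Proof.
move=> [Lw H] [Lw' H']; split; first exact: L2D.
move=> l; have [g Lg Hg] := H l; have [g' Lg' Hg'] := H' l.
by exists (fun q => g q + g' q); [exact: L2D|exact: weak_dxD].
Qed.

Lemma weakly_diffZ c w : weakly_diff w -> weakly_diff (fun q => c * w q).
Proof.
move=> [Lw H]; split; first exact: L2Z.
move=> l; have [g Lg Hg] := H l.
by exists (fun q => c * g q); [exact: L2Z|exact: weak_dxZ].
Qed.

(* The class is closed under products, which makes the sets whose indicators
   are limits of such functions a pi-system. *)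
Definition smooth_cutoff w :=
  [/\ measurable_fun setT w, forall q, 0 <= w q <= 1 &
   forall l : 'I_d, exists g, [/\ measurable_fun setT g,
     exists C, forall q, (forall i, 0 < tnth q.2 i < 1) -> `|g q| <= C &
     forall q, [/\ forall s : R, is_derive s (1 : R) (fun s => w (q.1, upd q.2 l s))
                                          (g (q.1, upd q.2 l s)),
               continuous (fun s => g (q.1, upd q.2 l s)) &
               w (q.1, upd q.2 l 0) = w (q.1, upd q.2 l 1)]]].

Lemma smooth_cutoff_L2 w : smooth_cutoff w -> w \in L2.
Proof.
move=> [mw w01 _]; apply: (L2_bounded (spacetime_measure_lty T d) mw (C := 1)).
by apply: aeW => q; have /andP[w0 w1] := w01 q; rewrite ger0_norm.
Qed.

(** The sum of [g phi] and [w dx l phi] is the derivative of [w phi] along the [l]-th coordinate,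
    and [w phi] takes equal values at 0 and 1. *)
Lemma smooth_cutoff_weakly_diff w : smooth_cutoff w -> weakly_diff w.
Proof.
move=> sw; have Lw := smooth_cutoff_L2 sw; case: sw => mw w01 H.
split=> // l; have [g [mg [C gC] Hq]] := H l.
have Lg : g \in L2.
  apply: (L2_bounded (spacetime_measure_lty T d) mg (C := C)).
  have FF := ae_filter_ringOfSetsType mu.
  by apply: filterS (ae_cube T d) => q; exact: gC.
exists g => // phi tp; have tdp := testfun_dx l tp.
apply/eqP; rewrite -subr_eq0 opprK -RintegralD//; [|exact: L2_intble (L2_testfun _ _)..].
apply/eqP; apply: (spacetime_integral0 (i := l)).
  by apply: intbleD; exact: L2_intble (L2_testfun _ _).
move=> q; have [dw cg w1] := Hq q; have [dp cp p1] := testfun_line l q.1 q.2 tp.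
have [_ cdp _] := testfun_line l q.1 q.2 tdp.
apply: (@unif_integral_derive _ (fun s => w (q.1, upd q.2 l s) * phi (q.1, row_of (upd q.2 l s)))).
- move=> s; have H1 := is_deriveM (dw s) (dp s).
  rewrite [X in is_derive _ _ _ X](_ : _ = w (q.1, upd q.2 l s) *: dx l phi (q.1, row_of (upd q.2 l s)) +
      phi (q.1, row_of (upd q.2 l s)) *: g (q.1, upd q.2 l s)); first exact: H1.
  by rewrite /point_of /= addrC; congr (_ + _); rewrite /GRing.scale/= mulrC.
- move=> s; apply: cvgD; apply: cvgM; [exact: cg|exact: cp| |exact: cdp].
  exact: is_derive_continuous (dw s).
- by rewrite w1 p1.
Qed.

Lemma smooth_cutoffM w w' : smooth_cutoff w -> smooth_cutoff w' ->
  smooth_cutoff (fun q => w q * w' q).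
Proof.
move=> [mw w01 H] [mw' w01' H']; split; first exact: measurable_funM.
- move=> q; have /andP[a0 a1] := w01 q; have /andP[b0 b1] := w01' q.
  by rewrite mulr_ge0//= mulr_ile1.
move=> l; have [g [mg [C gC] Hq]] := H l; have [g' [mg' [C' gC'] Hq']] := H' l.
exists (fun q => w q * g' q + w' q * g q); split.
- by apply: measurable_funD; exact: measurable_funM.
- exists (C' + C) => q cq; rewrite (le_trans (ler_normD _ _))// !normrM lerD//.
    have /andP[a0 a1] := w01 q; rewrite ger0_norm// -[leRHS]mul1r.
    by apply: ler_pM => //; exact: gC'.
  have /andP[a0 a1] := w01' q; rewrite ger0_norm// -[leRHS]mul1r.
  by apply: ler_pM => //; exact: gC.
- move=> q; have [dw cg w1] := Hq q; have [dw' cg' w1'] := Hq' q; split.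
  + by move=> s; exact: (is_deriveM (dw s) (dw' s)).
  + move=> s; apply: cvgD; apply: cvgM; [|exact: cg'| |exact: cg].
      exact: is_derive_continuous (dw s).
    exact: is_derive_continuous (dw' s).
  + by rewrite w1 w1'.
Qed.

(** Moving a space coordinate leaves the time fixed, so all the derivatives required are 0 and no
    smoothing in time takes place. *)
Lemma smooth_cutoff_time (A : set R) : measurable A ->
  smooth_cutoff (fun q => \1_A q.1).
Proof.
move=> mA; split.
- by apply: measurableT_comp => //; exact: measurable_indic.
- by move=> q; rewrite indicE ler0n lern1 leq_b1.
move=> l; exists (fun=> 0); split=> //; first by exists 0 => q _; rewrite normr0.
by move=> q; split=> //= s; [exact: is_derive_cst|exact: cst_continuous].
Qed.

Lemma C1_bounded (f : R -> R) : continuous f -> exists C, forall s, 0 <= s <= 1 -> `|f s| <= C.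
Proof.
move=> cf; have cf' : {within `[0, 1]%classic, continuous f} by exact: continuous_subspaceT.
have [M [_ HM]] := compact_bounded (continuous_compact cf' (@segment_compact R 0 1)).
exists (M + 1) => s s01; apply: (HM (M + 1)); first by rewrite ltrDl.
by exists s => //=; rewrite in_itv.
Qed.

Lemma smooth_cutoff_space (i : 'I_d) (f : R -> R) : C1 f -> (forall x, 0 <= f x <= 1) ->
  f 0 = f 1 -> smooth_cutoff (fun q => f (tnth q.2 i)).
Proof.
move=> Cf f01 f1; have mi : measurable_fun setT (fun q : spacetime R d => tnth q.2 i).
  by apply: (measurableT_comp (measurable_tnth i)); exact: measurable_snd.
split.
- by apply: (measurableT_comp _ mi); apply: continuous_measurable_fun; exact: C1_continuous.
- by move=> q; exact: f01.
move=> l; have [il|il] := eqVneq i l.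
  case: Cf => f' cf' df; exists (fun q => f' (tnth q.2 i)); split.
  - by apply: (measurableT_comp _ mi); exact: continuous_measurable_fun.
  - have [C HC] := C1_bounded cf'; exists C => q cq; apply: HC.
    by have /andP[/ltW-> /ltW->] := cq i.
  - move=> q; rewrite !tnth_upd il eqxx f1; split => //.
    + move=> s; rewrite (_ : (fun s => _) = f) ?tnth_upd ?eqxx//.
      by apply/funext => u; rewrite tnth_upd eqxx.
    + rewrite (_ : (fun s => _) = f')//.
      by apply/funext => u; rewrite tnth_upd eqxx.
exists (fun=> 0); split=> //; first by exists 0 => q _; rewrite normr0.
move=> q; rewrite !tnth_upd (negbTE il); split=> // s; last exact: cst_continuous.
rewrite (_ : (fun s => _) = fun=> f (tnth q.2 i)); first exact: is_derive_cst.
by apply/funext => u; rewrite tnth_upd (negbTE il).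
Qed.

Definition approximable F := F \in L2 /\
  forall e : R, 0 < e -> exists2 w, weakly_diff w & \int[mu]_q ((F q - w q) ^+ 2) <= e.

Lemma weakly_diff_approximable w : weakly_diff w -> approximable w.
Proof.
move=> ww; split; first by case: ww.
move=> e e0; exists w => //; under eq_Rintegral do rewrite subrr expr0n.
by rewrite Rintegral_cst// mul0r ltW.
Qed.

Lemma approximableD F G : approximable F -> approximable G -> approximable (fun q => F q + G q).
Proof.
move=> [LF AF] [LG AG]; split; first exact: L2D.
(* Two errors of e/4, each doubled by [Rintegral_sqrD]. *)
move=> e e0; have e4 : 0 < e / 4 by rewrite divr_gt0.
have [w ww Hw] := AF _ e4; have [v wv Hv] := AG _ e4.
exists (fun q => w q + v q); first exact: weakly_diffD.
have Lw : w \in L2 by case: ww.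
have Lv : v \in L2 by case: wv.
rewrite (_ : Rintegral _ _ _ = \int[mu]_q ((F q - w q) + (G q - v q)) ^+ 2); last first.
  by apply: eq_Rintegral => q _; congr (_ ^+ 2); ring.
apply: (le_trans (Rintegral_sqrD (L2B LF Lw) (L2B LG Lv))).
by rewrite (_ : e = 2 * (e / 4) + 2 * (e / 4)) ?lerD ?ler_wpM2l//; field.
Qed.

Lemma approximableZ c F : approximable F -> approximable (fun q => c * F q).
Proof.
move=> [LF AF]; split; first exact: L2Z.
(* The added 1 keeps the divisor positive when [c] is 0. *)
move=> e e0; have c0 : 0 < c ^+ 2 + 1 by rewrite ltr_wpDl ?sqr_ge0.
have [w ww Hw] := AF _ (divr_gt0 e0 c0); have Lw : w \in L2 by case: ww.
exists (fun q => c * w q); first exact: weakly_diffZ.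
rewrite (_ : Rintegral _ _ _ = c ^+ 2 * \int[mu]_q (F q - w q) ^+ 2); last first.
  rewrite -RintegralZl//; last exact: L2_sqr_integrable (L2B LF Lw).
  by apply: eq_Rintegral => q _; ring.
apply: (@le_trans _ _ ((c ^+ 2 + 1) * (e / (c ^+ 2 + 1)))); last by rewrite mulrC divfK ?gt_eqF.
apply: ler_pM; rewrite ?sqr_ge0 ?lerDl//; exact: Rintegral_sqr_ge0.
Qed.

Lemma approximable_cvg (F_ : nat -> spacetime R d -> R) F :
  (forall n, approximable (F_ n)) -> cvgL2 mu F_ F -> approximable F.
Proof.
move=> AF [LF_ LF cF]; split => // e e0; have e4 : 0 < e / 4 by rewrite divr_gt0.
have [n Hn] : exists n, \int[mu]_x (F_ n x - F x) ^+ 2 < e / 4.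
  have [N _ H] : \forall n \near \oo, \int[mu]_x (F_ n x - F x) ^+ 2 < e / 4.
    exact: (cvgr_lt _ cF).
  by exists N; apply: H => /=.
have [_ /(_ _ e4)[w ww Hw]] := AF n; exists w => //; have Lw : w \in L2 by case: ww.
rewrite (_ : Rintegral _ _ _ = \int[mu]_q (- (F_ n q - F q) + (F_ n q - w q)) ^+ 2); last first.
  by apply: eq_Rintegral => q _; congr (_ ^+ 2); ring.
apply: (le_trans (Rintegral_sqrD (L2N (L2B (LF_ n) LF)) (L2B (LF_ n) Lw))).
under eq_Rintegral do rewrite sqrrN.
by rewrite (_ : e = 2 * (e / 4) + 2 * (e / 4)) ?lerD ?ler_wpM2l ?(ltW Hn)//; field.
Qed.

Lemma approximable_sum n (F : 'I_n -> spacetime R d -> R) :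
  (forall i, approximable (F i)) -> approximable (fun q => \sum_(i < n) F i q).
Proof.
elim: n F => [F _|n IH F AF].
  under eq_fun do rewrite big_ord0.
  apply: weakly_diff_approximable; split; first exact: L2_cst (spacetime_measure_lty T d) _.
  move=> l; exists (fun=> 0); first exact: L2_cst (spacetime_measure_lty T d) _.
  by move=> phi _; rewrite -mulN1r; under eq_Rintegral do rewrite mul0r;
    under [in RHS]eq_Rintegral do rewrite mul0r; rewrite Rintegral_cst// mul0r mulr0.
under eq_fun do rewrite big_ord_recl.
by apply: approximableD => //; apply: IH => i; exact: AF.
Qed.

Definition cutoff_sets : set (set (spacetime R d)) :=
  [set A | measurable A /\ exists2 w_ : nat -> spacetime R d -> R,
     forall n, smooth_cutoff (w_ n) &
     {ae mu, forall q, w_ n q @[n --> \oo] --> (\1_A q : R)}].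

Lemma cutoff_sets_setI : setI_closed cutoff_sets.
Proof.
move=> A B [mA [w_ sw cw]] [mB [v_ sv cv]]; split; first exact: measurableI.
exists (fun n q => w_ n q * v_ n q); first by move=> n; exact: smooth_cutoffM.
have FF := ae_filter_ringOfSetsType mu.
apply: filterS (filterI cw cv) => q [cwq cvq]; rewrite indicI.
exact: seq_cvgM.
Qed.

Lemma cutoff_sets_time (A : set R) : measurable A -> cutoff_sets (fst @^-1` A).
Proof.
move=> mA; split; first by rewrite -[X in measurable X]setTI; exact: measurable_fst.
exists (fun _ q => \1_A q.1); first by move=> n; exact: smooth_cutoff_time.
by apply: aeW => q; rewrite -[X in _ --> X]/(\1_A q.1); exact: cvg_cst.
Qed.

Lemma cutoff_sets_ray (i : 'I_d) (a : R) :
  cutoff_sets ((fun q => tnth q.2 i) @^-1` `]a, +oo[%classic).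
Proof.
split.
  rewrite -[X in measurable X]setTI.
  have : measurable_fun setT (fun q : spacetime R d => tnth q.2 i).
    by apply: (measurableT_comp (measurable_tnth i)); exact: measurable_snd.
  by apply; [exact: measurableT|exact: measurable_itv].
exists (fun n q => ray_approx a n (tnth q.2 i)).
  move=> n; apply: smooth_cutoff_space; [exact: C1_ray_approx|exact: ray_approx_ge0_le1|].
  by rewrite ray_approx0 ray_approx1.
have FF := ae_filter_ringOfSetsType mu.
apply: filterS (ae_cube T d) => q cq; have := cvg_ray_approx (a := a) (cq i).
rewrite !indicE; congr (_ --> (_%:R : R)); congr nat_of_bool.
by apply/idP/idP; rewrite !inE /= in_itv /= andbT.
Qed.

(** The inclusion from left to right says that the identity is measurable from the generated
    sigma-algebra. This can be tested on the time and on each coordinate, and for a coordinate on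
    rays. *)
Lemma measurable_cutoff_sets : @measurable _ (spacetime R d) = <<s cutoff_sets >>.
Proof.
apply/seteqP; split; last first.
  by apply: smallest_sub; [exact: sigma_algebra_measurable|move=> A []].
move=> A mA; pose X := g_sigma_algebraType cutoff_sets.
have mid : measurable_fun setT ((fun q => q) : X -> spacetime R d).
  apply/measurable_fun_pairP; split.
    by move=> _ B mB; rewrite setTI; apply: sub_sigma_algebra; exact: cutoff_sets_time.
  apply/measurable_fun_tnthP => i.
  apply: (measurability _ (RGenOInfty.measurableE R)) => /= _ [_ [a ->] <-].
  by rewrite setTI; apply: sub_sigma_algebra; exact: cutoff_sets_ray.
by have := mid measurableT A mA; rewrite setTI.
Qed.

Lemma indic_L2 A : measurable A -> (\1_A : spacetime R d -> R) \in L2.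
Proof.
move=> mA; apply: (L2_bounded (spacetime_measure_lty T d) (measurable_indic mA) (C := 1)).
by apply: aeW => q; rewrite indicE ger0_norm// lern1 leq_b1.
Qed.

Lemma approximable_cst c : approximable (fun=> c).
Proof.
have := approximableZ c (weakly_diff_approximable (smooth_cutoff_weakly_diff (smooth_cutoff_time measurableT))).
by congr approximable; apply/funext => q; rewrite indicT mulr1.
Qed.

(** Dynkin's pi-lambda theorem. Complements are handled by linearity, disjoint unions by dominated
    convergence of the partial sums of indicators. *)
Lemma approximable_indic A : measurable A -> approximable (\1_A).
Proof.
have Lone : (fun=> 1) \in L2 by exact: L2_cst (spacetime_measure_lty T d) 1.
rewrite measurable_cutoff_sets.
apply: (dynkin_induction (P := fun B => approximable (\1_B)) measurable_cutoff_sets).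
- exact: cutoff_sets_setI.
- by rewrite indicT; exact: approximable_cst.
- move=> B [mB [w_ sw cw]]; apply: (approximable_cvg (F_ := w_)).
    by move=> n; exact/weakly_diff_approximable/smooth_cutoff_weakly_diff.
  apply: (cvgL2_dominated (H := fun=> 1)) => //.
  + by move=> n; exact: smooth_cutoff_L2.
  + exact: indic_L2.
  + move=> n; apply: aeW => q; have [_ /(_ q)/andP[w0 w1] _] := sw n.
    by rewrite ger0_norm.
  + by apply: aeW => q; rewrite indicE ger0_norm// lern1 leq_b1.
- move=> B mB AB; have := approximableD (approximable_cst 1) (approximableZ (-1) AB).
  congr approximable; apply/funext => q; rewrite !indicE in_setC.
  by case: (q \in B); rewrite /= ?mulr1 ?subrr// mulr0 addr0.
- move=> B mB tB AB.
  (* By disjointness at most one indicator is 1 at [q], say the [k]-th; the sum over indices below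
     [n] contains it exactly when k < n. *)
  have sE q : (exists2 k, B k q & forall n, \sum_(i < n) \1_(B i) q = (k < n)%:R :> R) \/
     (~ (\bigcup_k B k) q /\ forall n, \sum_(i < n) \1_(B i) q = 0 :> R).
    have [[k _ Bkq]|nB] := pselect ((\bigcup_k B k) q); [left|right].
      exists k => // n; under eq_bigr => i _.
        rewrite indicE (_ : (q \in B i) = (i == k :> nat)); first over.
        apply/idP/eqP => [|->]; last by rewrite inE.
        by rewrite inE => Biq; apply: (tB _ _ I I); exists q.
      elim: n => [|n IH]; first by rewrite big_ord0.
      rewrite big_ord_recr /= IH ltnS.
      by case: ltngtP => _; rewrite ?add0r ?addr0.
    split=> // n; rewrite big1// => i _; rewrite indicE memNset// => Biq.
    by apply: nB; exists i.
  apply: (approximable_cvg (F_ := fun n q => \sum_(i < n) \1_(B i) q)).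
    by move=> n; apply: approximable_sum => i; exact: AB.
  apply: (cvgL2_dominated (H := fun=> 1)) => //.
  + by move=> n; apply: L2_sum => i; apply: indic_L2; exact: mB.
  + by apply: indic_L2; exact: bigcup_measurable.
  + apply: aeW => q; rewrite indicE; case: (sE q) => [[k Bkq sEq]|[nB sEq]].
      rewrite mem_set; last by exists k.
      apply: cvg_near_cst; exists k.+1 => // n /= kn.
      by rewrite sEq kn.
    rewrite memNset//; apply: cvg_near_cst; apply: nearW => n; exact: sEq.
  + move=> n; apply: aeW => q; case: (sE q) => [[k _ ->]|[_ ->]]; last by rewrite normr0.
    by rewrite ger0_norm// lern1 leq_b1.
  + by apply: aeW => q; rewrite indicE ger0_norm// lern1 leq_b1.
Qed.

Lemma L2_max F G : F \in L2 -> G \in L2 -> (fun q => Num.max (F q) (G q)) \in L2.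
Proof.
move=> LF LG; have mF := L2_measurable LF; have mG := L2_measurable LG.
have mm : measurable_fun setT (fun q => Num.max (F q) (G q)) by exact: measurable_maxr.
apply/L2P; split => //.
have /integrableP[mI] := intbleD (L2_sqr_integrable LF) (L2_sqr_integrable LG).
apply: le_lt_trans; apply: ge0_le_integral => //.
- by move=> x _; rewrite lee_fin sqr_ge0.
- by apply/measurable_EFinP; exact: measurable_funX.
- exact: measurableT_comp.
- move=> x _ /=; rewrite lee_fin ger0_norm ?addr_ge0 ?sqr_ge0//.
  by case: (leP (F x) (G x)) => _; rewrite ?lerDl ?lerDr sqr_ge0.
Qed.

(** An increasing sequence of simple functions converges to [F] pointwise and is dominated by [F]
    itself. *)
Lemma approximable_ge0 F : F \in L2 -> (forall q, 0 <= F q) -> approximable F.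
Proof.
move=> LF F0; have mF : measurable_fun setT (EFin \o F).
  by apply/measurable_EFinP; exact: L2_measurable LF.
pose g := nnsfun_approx measurableT mF.
have cg q : g n q @[n --> \oo] --> F q.
  have := @cvg_nnsfun_approx _ _ _ _ measurableT _ mF (fun x _ => F0 x) q I.
  by move=> /fine_cvg.
have gF n q : 0 <= g n q <= F q.
  rewrite fun_ge0/=; have : nondecreasing_seq (fun k => g k q).
    by move=> i j ij; have /lefP := nd_nnsfun_approx measurableT mF ij; exact.
  move=> nd; have := nondecreasing_cvgn_le nd (cvgP _ (cg q)) n.
  by rewrite (cvg_lim _ (cg q)).
apply: (approximable_cvg (F_ := fun n => g n : spacetime R d -> R)).
  move=> n; have /funext -> := fimfunEord (g n).
  apply: approximable_sum => i; apply: approximableZ; apply: approximable_indic.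
  exact: measurable_funPTI.
have Lg n : (g n : _ -> R) \in L2.
  apply/L2P; split; first exact: measurable_funP.
  have /L2P[_] := LF; apply: le_lt_trans; apply: ge0_le_integral => //.
  - by move=> x _; rewrite lee_fin sqr_ge0.
  - by apply/measurable_EFinP; apply: measurable_funX; exact: measurable_funP.
  - by apply/measurable_EFinP; apply: measurable_funX; exact: L2_measurable LF.
  - by move=> x _; rewrite lee_fin; have /andP[? ?] := gF n x; rewrite ler_sqr ?nnegrE.
apply: (cvgL2_dominated (H := F)) => //.
- by apply: aeW.
- by move=> n; apply: aeW => q; have /andP[? ?] := gF n q; rewrite ger0_norm.
- by apply: aeW => q; rewrite ger0_norm.
Qed.

Lemma L2_approximable F : F \in L2 -> approximable F.
Proof.
move=> LF; have Lz : (fun=> 0) \in L2 by exact: L2_cst (spacetime_measure_lty T d) 0.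
have Lp := L2_max LF Lz; have Ln := L2_max (L2N LF) Lz.
(* Positive part minus negative part. *)
have := approximableD (approximable_ge0 Lp _) (approximableZ (-1) (approximable_ge0 Ln _)).
rewrite (_ : (fun q => _) = F); first by apply => q; rewrite le_max lexx orbT.
apply/funext => q; case: (leP 0 (F q)) => F0.
  by rewrite max_r ?oppr_le0// mulr0 addr0.
by rewrite max_l ?oppr_ge0 ?(ltW F0)// mulrNN mul1r add0r.
Qed.

End density.

(** * Lower bound *)

Section limits.
Context {R : realType}.
Implicit Types u v : nat -> \bar R.

Lemma le_limn_einf u v : (forall n, (u n <= v n)%E) -> (limn_einf u <= limn_einf v)%E.
Proof.
move=> uv; rewrite !limn_einf_lim; apply: lee_lim; [exact: is_cvg_einfs|exact: is_cvg_einfs|].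
apply: nearW => n; apply: le_ereal_inf_tmp => _ [k /= nk <-].
by apply: (le_trans _ (uv k)); apply: ereal_inf_lbound; exists k.
Qed.

Lemma le_limn_esup u v : (forall n, (u n <= v n)%E) -> (limn_esup u <= limn_esup v)%E.
Proof.
move=> uv; have := @le_limn_einf (fun n => - v n)%E (fun n => - u n)%E.
rewrite (limn_einfN u) (limn_einfN v) leeN2; apply => n.
by rewrite leeN2.
Qed.

End limits.

Section conull.
Context {R : realType} {disp : measure_display} {X : measurableType disp}.
Variable mu : {measure set X -> \bar R}.
Import HBNNSimple.

(* An admissible pair is arbitrary off the slab, so the integrands of [calM] need
   not be measurable; the supremum defining the integral does not see this. *)
Lemma ge0_le_integral_conull (D : set X) (f g : X -> \bar R) : measurable D ->
  mu (~` D) = 0%E -> (forall x, D x -> f x = g x) ->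
  (forall x, 0 <= f x)%E -> (forall x, 0 <= g x)%E ->
  (\int[mu]_x f x <= \int[mu]_x g x)%E.
Proof.
move=> mD D0 fg f0 g0; rewrite !ge0_integralTE//; apply: ge_ereal_sup => _ [h /= hf <-].
(* Set to 0 off [D], a simple function below [f] lies below [g] everywhere and keeps its
   integral. *)
apply: ereal_sup_ubound; exists (proj_nnsfun h mD) => /=.
  move=> x; rewrite mindicE; case: (boolP (x \in D)) => [/set_mem Dx|_] /=.
    by rewrite mulr1 -fg.
  by rewrite mulr0.
rewrite -!integralT_nnsfun; apply: ae_eq_integral => //.
- by apply/measurable_EFinP; exact: measurable_funP.
- by apply/measurable_EFinP; exact: measurable_funP.
- exists (~` D); split => //; first exact: measurableC.
  move=> x /= H Dx; apply: H => _; rewrite mindicE mem_set// mulr1//.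
Qed.

Lemma Rintegral_conull (D : set X) (f g : X -> R) : measurable D ->
  mu (~` D) = 0%E -> (forall x, D x -> f x = g x) ->
  \int[mu]_x f x = \int[mu]_x g x.
Proof.
move=> mD D0 fg; rewrite /Rintegral [in LHS]integralE [in RHS]integralE; congr (fine (_ - _)%E).
- by apply/eqP; rewrite eq_le; apply/andP; split; apply: (ge0_le_integral_conull mD D0) => // x Dx;
    rewrite !funeposE fg.
- by apply/eqP; rewrite eq_le; apply/andP; split; apply: (ge0_le_integral_conull mD D0) => // x Dx;
    rewrite !funenegE fg.
Qed.

End conull.

(** * Extending fields that are continuous only on the slab *)

Section clamp.
Context {R : realType} {d : nat}.
Variable T : R.
Hypothesis T0 : 0 < T.

(** A retraction onto the slab. Composing with it makes a field that is continuous within the slab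
    continuous everywhere, hence measurable, and changes nothing on the support of the time
    measure. *)
Definition clamp (p : R * 'rV[R]_d) : R * 'rV[R]_d := (Num.max 0 (Num.min p.1 T), p.2).

Lemma clamp_slab p : slab T (clamp p).
Proof. by rewrite /slab /clamp /= le_max lexx /= ge_max ge_min lexx orbT (ltW T0). Qed.

Lemma clamp_id p : slab T p -> clamp p = p.
Proof.
rewrite /slab /= => /andP[p0 pT]; case: p p0 pT => t y /= p0 pT.
by rewrite /clamp /= min_l// max_r.
Qed.

Lemma clamp_continuous : continuous clamp.
Proof.
move=> p; pose m (p : R * 'rV[R]_d) := Num.max 0 (Num.min p.1 T).
have H : m q @[q --> p] --> m p.
  apply: (@continuous_max R _ (cst 0) (fun p : R * 'rV[R]_d => Num.min p.1 T)); first exact: cst_continuous.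
  apply: (@continuous_min R _ fst (cst T)); last exact: cst_continuous.
  exact: cvg_fst.
have H2 : snd q @[q --> p] --> snd p by exact: cvg_snd.
exact: (@cvg_pair _ _ _ (nbhs p) _ _ _ _ _ m snd H H2).
Qed.

Lemma continuous_clamp (f : R * 'rV[R]_d -> R) : {within slab T, continuous f} ->
  continuous (f \o clamp).
Proof.
move=> /subspace_continuousP cf p; have := cf _ (clamp_slab p) => H.
have K : clamp q @[q --> p] --> within (slab T) (nbhs (clamp p)).
  move=> A; rewrite /within /= => nA; have nA' : \forall q \near p, slab T (clamp q) -> A (clamp q) by exact: (@clamp_continuous p _ nA).
  change (\forall q \near p, A (clamp q)).
  by apply: filterS nA' => q H2; exact: (H2 (clamp_slab q)).
exact: (@cvg_comp _ _ _ clamp f _ _ _ K H).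
Qed.

End clamp.

(** * Norms of matrix fields and convergence of their entries *)

Section Lp_norms.
Context {R : realType} {disp : measure_display} {X : measurableType disp}.
Variable mu : {measure set X -> \bar R}.
Variables m n : nat.
Implicit Types F : X -> 'M[R]_(m, n).

Lemma frob_sqr (A : 'M[R]_(m, n)) : frob A ^+ 2 = \sum_i \sum_j A i j ^+ 2.
Proof. by rewrite sqr_sqrtr// sumr_ge0// => i _; rewrite sumr_ge0// => j _; rewrite sqr_ge0. Qed.

Lemma le_coord_frob (A : 'M[R]_(m, n)) i j : `|A i j| <= frob A.
Proof.
rewrite -(@ler_pXn2r _ 2)// ?nnegrE ?sqrtr_ge0// frob_sqr real_normK ?num_real//.
rewrite (bigD1 i)//= (bigD1 j)//= -addrA lerDl addr_ge0// sumr_ge0// => *; rewrite ?sqr_ge0//.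
by rewrite sumr_ge0// => *; rewrite sqr_ge0.
Qed.

Lemma Lp_norm2E F : Lp_field mu 2%:E F ->
  Lp_norm mu 2%:E F = (Num.sqrt (\sum_i \sum_j \int[mu]_x (F x i j ^+ 2)))%:E.
Proof.
move=> LF; rewrite /Lp_norm unlock.
have I i j := L2_sqr_integrable (LF i j).
rewrite (_ : (\int[mu]_x _)%E = (\sum_i \sum_j \int[mu]_x (F x i j ^+ 2))%:E).
  rewrite poweR_EFin; congr _%:E; rewrite -powR12_sqrt//.
  by rewrite sumr_ge0// => i _; rewrite sumr_ge0// => j _; exact: Rintegral_sqr_ge0.
under eq_integral => x _.
  rewrite abse_EFin poweR_EFin powR_mulrn// ger0_norm ?sqrtr_ge0// frob_sqr; over.
under eq_bigr do rewrite -Rintegral_sum//.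
rewrite -Rintegral_sum; last by move=> i; exact: intble_sum.
rewrite /Rintegral fineK//; apply: integrable_fin_num => //.
by apply: intble_sum => i; exact: intble_sum.
Qed.

Lemma Lp_normy_le F (C : R) : (Lp_norm mu +oo F <= C%:E)%E ->
  {ae mu, forall x, forall i j, `|F x i j| <= C}.
Proof.
rewrite /Lp_norm unlock; case: ifPn => [muT|].
  move=> /ess_supP; apply: filterS => x /=; rewrite lee_fin => H i j.
  by rewrite (le_trans (le_coord_frob _ _ _))// (le_trans (ler_norm _)).
(* The whole space is null here, so any property holds almost everywhere. *)
rewrite -leNgt => muT _; exists setT; split => //.
by apply/eqP; rewrite -measure_le0.
Qed.

Lemma Lp_norm0 p : p != 0%E -> Lp_norm mu p (fun=> 0 : 'M[R]_(m, n)) = 0%E.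
Proof.
move=> p0; rewrite /Lp_norm -[RHS](Lnorm0 mu p0); apply: eq_Lnorm => x /=.
rewrite (_ : frob _ = 0)// /frob big1 ?sqrtr0// => i _; rewrite big1// => j _.
by rewrite mxE expr0n.
Qed.

Lemma Lp_norm_ge0 p F : (0 <= Lp_norm mu p F)%E.
Proof. exact: Lnorm_ge0. Qed.

Lemma Lp_fieldB (F G : X -> 'M[R]_(m, n)) : Lp_field mu 2%:E F -> Lp_field mu 2%:E G ->
  Lp_field mu 2%:E (fun x => F x - G x).
Proof. by move=> LF LG i j; apply: L2_eq (L2B (LF i j) (LG i j)) => x; rewrite !mxE. Qed.

Lemma Lp_norm2_cvg0 (F_ : nat -> X -> 'M[R]_(m, n)) : (forall k, Lp_field mu 2%:E (F_ k)) ->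
  Lp_norm mu 2%:E (F_ k) @[k --> \oo] --> 0%E <->
  \sum_i \sum_j \int[mu]_x (F_ k x i j ^+ 2) @[k --> \oo] --> (0 : R).
Proof.
move=> LF; split.
- move=> /fine_cvg.
  rewrite (_ : _ \o _ = fun k => Num.sqrt (\sum_i \sum_j \int[mu]_x (F_ k x i j ^+ 2))); last first.
    by apply/funext => k /=; rewrite Lp_norm2E.
  move=> H; have := seq_cvgM H H; rewrite mulr0; apply: cvg_eqfun => k.
  by rewrite -expr2 sqr_sqrtr// sumr_ge0// => i _; rewrite sumr_ge0// => j _; exact: Rintegral_sqr_ge0.
- move=> H; under eq_cvg do rewrite Lp_norm2E//.
  apply: cvg_EFin; first exact: nearW.
  rewrite -[X in _ --> X]sqrtr0.
  exact: (continuous_cvg _ (@sqrt_continuous R _) H).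
Qed.

Lemma Lp_norm2_cvgL2 (F_ : nat -> X -> 'M[R]_(m, n)) F :
  (forall k, Lp_field mu 2%:E (F_ k)) -> Lp_field mu 2%:E F ->
  Lp_norm mu 2%:E (fun x => F_ k x - F x) @[k --> \oo] --> 0%E ->
  forall i j, cvgL2 mu (fun k x => F_ k x i j) (fun x => F x i j).
Proof.
move=> LF_ LF H0 i j; split; [by move=> k; exact: LF_|exact: LF|].
have H := (Lp_norm2_cvg0 (fun k => Lp_fieldB (LF_ k) LF)).1 H0.
apply: (cvg_squeeze0 _ H).
move=> k; rewrite Rintegral_sqr_ge0/= (bigD1 i)//= (bigD1 j)//= -addrA.
rewrite (_ : \int[mu]_x (F_ k x i j - F x i j) ^+ 2 = \int[mu]_x ((F_ k x - F x) i j) ^+ 2); last first.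
  by apply: eq_Rintegral => x _; rewrite !mxE.
rewrite lerDl addr_ge0// sumr_ge0// => *; rewrite ?Rintegral_sqr_ge0//.
by rewrite sumr_ge0// => *; rewrite Rintegral_sqr_ge0.
Qed.

Lemma Lp_normy_cvgL2 (F_ : nat -> X -> 'M[R]_(m, n)) F : (mu setT < +oo)%E ->
  (forall k, Lp_field mu 2%:E (F_ k)) -> Lp_field mu 2%:E F ->
  Lp_norm mu +oo%E (fun x => F_ k x - F x) @[k --> \oo] --> 0%E ->
  forall i j, cvgL2 mu (fun k x => F_ k x i j) (fun x => F x i j).
Proof.
move=> muT LF_ LF H i j; split; [by move=> k; exact: LF_|exact: LF|].
pose M := fine (mu setT).
have M0 : 0 <= M by rewrite fine_ge0.
(* The norm may be infinite for finitely many indices, so its real value bounds it only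
   eventually. *)
have [C [C0 HC]] : exists C : nat -> R, C k @[k --> \oo] --> (0 : R) /\
    \forall k \near \oo, (Lp_norm mu +oo%E (fun x => F_ k x - F x)%R <= (C k)%:E)%E.
  exists (fun k => fine (Lp_norm mu +oo%E (fun x => F_ k x - F x))); split; first exact: (fine_cvg H).
  have /fine_cvgP[HN _] := H; apply: filterS HN => k Hk; by rewrite fineK.
have HC2 := seq_cvgZ (c := M) (seq_cvgM C0 C0); rewrite !mulr0 in HC2.
apply: (squeeze_cvgr (f := fun=> 0) (h := fun k => M * (C k * C k))) => //; last exact: cvg_cst.
apply: filterS HC => k /Lp_normy_le HC; rewrite Rintegral_sqr_ge0/=.
rewrite mulrC -Rintegral_cst//; apply: ae_le_Rintegral.
- exact: L2_sqr_integrable (L2B (LF_ k i j) (LF i j)).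
- by have := L2_sqr_integrable (L2_cst muT (C k)); apply: intble_eq => x; rewrite expr2.
- apply: filterS HC => x /(_ i j); rewrite !mxE => HC.
  by rewrite -expr2 -[leLHS]real_normK ?num_real// ler_sqr ?nnegrE// (le_trans _ HC).
Qed.

End Lp_norms.

Section powers.
Context {R : realType}.

Lemma cvg_powR0 (b : R) (nu : nat -> R) : 0 < b -> (forall n, 0 < nu n) ->
  nu n @[n --> \oo] --> (0 : R) -> nu n `^ b @[n --> \oo] --> (0 : R).
Proof.
move=> b0 nu0 cnu; apply/cvgrPdist_lt => e e0.
have e1 : 0 < e `^ b^-1 by rewrite powR_gt0.
have /cvgrPdist_lt/(_ _ e1) := cnu; apply: filterS => n.
rewrite !sub0r !normrN !gtr0_norm ?powR_gt0// => H.
have := @gt0_ltr_powR _ _ b0 (nu n) (e `^ b^-1).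
rewrite -powRrM mulVf ?gt_eqF// powRr1 ?(ltW e0)//; apply => //; rewrite ?in_itv /= ?andbT ?nnegrE ltW//.
Qed.

Lemma seq_cvg_EFin (u : nat -> R) (l : R) : u n @[n --> \oo] --> l ->
  (u n)%:E @[n --> \oo] --> l%:E.
Proof. by move=> ul; apply: cvg_EFin; [exact: nearW|exact: ul]. Qed.

End powers.

Section fields.
Context {R : realType} {d : nat}.
Variable T : R.
Hypothesis T0 : 0 < T.
Local Notation mu := (spacetime_measure T d).
Local Notation X := (spacetime R d).

Lemma cvgI_ext (F_ F_' : nat -> X -> R) (F F' : X -> R) : cvgI mu F_ F ->
  (forall n q, F_ n q = F_' n q) -> (forall q, F q = F' q) -> cvgI mu F_' F'.
Proof.
move=> H e1 e2; have -> : F_' = F_ by apply/funext => n; apply/funext => q.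
by have -> : F' = F by apply/funext => q.
Qed.

Lemma cvgL2_ext (F_ F_' : nat -> X -> R) (F F' : X -> R) : cvgL2 mu F_ F ->
  (forall n q, F_ n q = F_' n q) -> (forall q, F q = F' q) -> cvgL2 mu F_' F'.
Proof.
move=> H e1 e2; have -> : F_' = F_ by apply/funext => n; apply/funext => q.
by have -> : F' = F by apply/funext => q.
Qed.

Lemma cvgI_mulb (F_ : nat -> X -> R) (F g : X -> R) : cvgL2 mu F_ F ->
  measurable_fun setT g -> (exists C, {ae mu, forall q, `|g q| <= C}) ->
  cvgI mu (fun n q => F_ n q * g q) (fun q => F q * g q).
Proof.
move=> H mg [C gC]; apply: cvgI_mul => //; apply: cvgL2_cst.
exact: (L2_bounded (spacetime_measure_lty T d) mg gC).
Qed.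

Lemma cvgI_testfun (F_ : nat -> X -> R) (F : X -> R) phi : cvgL2 mu F_ F -> testfun phi ->
  cvgI mu (fun n q => F_ n q * phi (point_of q)) (fun q => F q * phi (point_of q)).
Proof.
move=> H tp; apply: cvgI_mulb => //; first exact: testfun_measurable.
exact: testfun_bounded.
Qed.

Lemma clamp_field (m n : nat) (Z : R * 'rV[R]_d -> 'M[R]_(m, n)) i j :
  {within slab T, continuous Z} ->
  measurable_fun setT (fun q : X => Z (clamp T (point_of q)) i j) /\
  (exists C, {ae mu, forall q, `|Z (clamp T (point_of q)) i j| <= C}).
Proof.
move=> cZ.
have cz : {within slab T, continuous (fun p => Z p i j)}.
  apply/subspace_continuousP => p sp; have /subspace_continuousP/(_ _ sp) H := cZ.
  have K := @coord_continuous R m n i j (Z p).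
  exact: (@cvg_comp _ _ _ Z (fun M : 'M[R]_(m, n) => M i j) _ _ _ H K).
have cc := continuous_clamp T0 cz; split; first exact: (measurable_fun_point_of cc).
by apply: (@ae_bounded_slab _ _ T (fun p => Z (clamp T p) i j)); exact: continuous_subspaceT.
Qed.

Definition pairing (E : X -> 'rV[R]_d) (N : X -> 'M[R]_d) (Z : R * 'rV[R]_d -> 'rV[R]_d)
    (M : R * 'rV[R]_d -> 'M[R]_d) (q : X) : R :=
  (\sum_i 2 * E q 0 i * Z (point_of q) 0 i) -
  \sum_i \sum_j N q i j * M (point_of q) i j.

Lemma measurable_time_slab : measurable (fst @^-1` `[0, T]%classic : set X).
Proof. by rewrite -[X in measurable X]setTI; exact: measurable_fst. Qed.

Lemma time_slab_conull : mu (~` (fst @^-1` `[0, T]%classic)) = 0%E.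
Proof.
apply: measure_negligible; first by apply: measurableC; exact: measurable_time_slab.
by apply: negligibleS (ae_time T d) => q /= H K; apply: H; rewrite in_itv.
Qed.

Lemma Rintegral_pairing_clamp E N Z M :
  \int[mu]_q pairing E N Z M q = \int[mu]_q pairing E N (Z \o clamp T) (M \o clamp T) q.
Proof.
apply: (Rintegral_conull measurable_time_slab time_slab_conull) => q /=.
rewrite in_itv /= => qT; rewrite /pairing /= clamp_id//.
Qed.

Lemma cvgI_pairing (E_ : nat -> X -> 'rV[R]_d) (E : X -> 'rV[R]_d)
    (N_ : nat -> X -> 'M[R]_d) (N : X -> 'M[R]_d)
    (Z : R * 'rV[R]_d -> 'rV[R]_d) (M : R * 'rV[R]_d -> 'M[R]_d) :
  (forall i, cvgL2 mu (fun n q => E_ n q 0 i) (fun q => E q 0 i)) ->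
  (forall i j, cvgL2 mu (fun n q => N_ n q i j) (fun q => N q i j)) ->
  {within slab T, continuous Z} -> {within slab T, continuous M} ->
  cvgI mu (fun n => pairing (E_ n) (N_ n) (Z \o clamp T) (M \o clamp T))
          (pairing E N (Z \o clamp T) (M \o clamp T)).
Proof.
move=> cE cN cZ cM; apply: cvgIB; apply: cvgI_sum => i.
  by have [mZ bZ] := clamp_field 0 i cZ; apply: cvgI_mulb => //; exact: cvgL2Z.
apply: cvgI_sum => j; have [mM bM] := clamp_field i j cM.
by apply: cvgI_mulb.
Qed.

Definition L2_triple (x : triple R d) :=
  [/\ Lp_field mu 2%:E (tE x), Lp_field mu 2%:E (tB x) & Lp_field mu 2%:E (tchi x)].

(** All that the proof uses of convergence in the metric. As the measure is finite, the uniform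
    convergence of [B] also gives convergence in L2, and the three components can be treated
    alike. *)
Definition cvg_triple (u : nat -> triple R d) (x : triple R d) :=
  [/\ forall i, cvgL2 mu (fun n q => tE (u n) q 0 i) (fun q => tE x q 0 i),
      forall i j, cvgL2 mu (fun n q => tB (u n) q i j) (fun q => tB x q i j) &
      forall i j, cvgL2 mu (fun n q => tchi (u n) q i j) (fun q => tchi x q i j)].

Lemma EBPsi_L2 nu x : EBPsi T nu x -> L2_triple x.
Proof.
move=> [LE LB Lc _ _]; split => // i j; have := LB i j.
apply: (@Lfun_subset _ _ _ mu 2%:E +oo%E); rewrite ?lee1n ?leey//.
by rewrite ge0_fin_numE//; exact: spacetime_measure_lty.
Qed.

Lemma EBPsi_union_L2 x : EBPsi_union T x -> L2_triple x.
Proof. by move=> [nu _]; exact: EBPsi_L2. Qed.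

Lemma dist_cvg_triple u x : (forall n, L2_triple (u n)) -> L2_triple x ->
  dist_cvg (EBPsi_dist T) u x -> cvg_triple u x.
Proof.
move=> Lu [LE LB Lc]; rewrite /dist_cvg /EBPsi_dist => H.
pose a n := Lp_norm mu 2%:E (fun q => tE (u n) q - tE x q).
pose b n := Lp_norm mu +oo (fun q => tB (u n) q - tB x q).
pose c n := Lp_norm mu 2%:E (fun q => tchi (u n) q - tchi x q).
have sq (v : nat -> \bar R) : (forall n, 0 <= v n)%E -> (forall n, v n <= a n + b n + c n)%E ->
    v n @[n --> \oo] --> 0%E.
  move=> v0 va; apply: (squeeze_cvge (f := fun=> 0%E) _ _ H); last exact: cvg_cst.
  by apply: nearW => n; rewrite v0 va.
have a0 n : (0 <= a n)%E by exact: Lp_norm_ge0.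
have b0 n : (0 <= b n)%E by exact: Lp_norm_ge0.
have c0 n : (0 <= c n)%E by exact: Lp_norm_ge0.
split.
- move=> i; apply: (Lp_norm2_cvgL2 (F_ := fun n => tE (u n))) => //.
    by move=> n; case: (Lu n).
  by apply: (sq a) => // n; rewrite -addeA leeDl// adde_ge0.
- apply: (Lp_normy_cvgL2 (F_ := fun n => tB (u n))) => //.
  + exact: spacetime_measure_lty.
  + by move=> n; case: (Lu n).
  + by apply: (sq b) => // n; rewrite addeAC leeDr// adde_ge0.
- apply: (Lp_norm2_cvgL2 (F_ := fun n => tchi (u n))) => //.
    by move=> n; case: (Lu n).
  by apply: (sq c) => // n; rewrite leeDr// adde_ge0.
Qed.

(** * Limits in the action and in the weak equation *)

Section action.
Variables (aV aW alpha : R).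
Hypothesis alpha0 : 0 < alpha.
Variables (Vbar : X -> 'rV[R]_d) (Wbar : X -> 'M[R]_d).
Variables (V0 : torus R d -> 'rV[R]_d) (gradV0 : torus R d -> 'M[R]_d).
Hypotheses (LV : Lp_field mu 2%:E Vbar) (LW : Lp_field mu 2%:E Wbar).
Hypotheses (LV0 : Lp_field (cube_measure d) 2%:E V0).
Hypotheses (LG0 : Lp_field (cube_measure d) 2%:E gradV0).

Definition shifted_aV (nu : R) := aV + nu `^ alpha.

(** The real-valued part of the action, which converges along the sequence; an infinite value can
    only come from [calM]. *)
Definition action_rest (nu : R) (x : triple R d) : R :=
  (\int[mu]_q ((\sum_i V0 q.2 0 i * tE x q 0 i)
                 + 2 * nu * (\sum_i \sum_l gradV0 q.2 i l * tchi x q i l)))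
    + (\int[mu]_q ((2 * aW)^-1 * frob (tchi x q - tB x q - aW *: Wbar q) ^+ 2))
    - (\int[mu]_q (shifted_aV nu / 2 * frob (Vbar q) ^+ 2
                   + aW / 2 * frob (Wbar q) ^+ 2)).

Lemma action_NSE nu x : action_NS T aV aW alpha Vbar Wbar V0 gradV0 nu x =
  (calM T (fun q => tE x q - shifted_aV nu *: Vbar q)%R (Nmat (shifted_aV nu) (tB x)) +
   (action_rest nu x)%:E)%E.
Proof. by []. Qed.

(** A zero exponent would give the power 1; positivity of [alpha] makes the shift vanish at
    viscosity 0. *)
Lemma shifted_aV0 : shifted_aV 0 = aV.
Proof. by rewrite /shifted_aV powR0 ?gt_eqF// addr0. Qed.

Lemma calM_ge E N Z M : admissible T (Z, M) ->
  ((2^-1 * \int[mu]_q pairing E N Z M q)%:E <= calM T E N)%E.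
Proof. by move=> adm; apply: ereal_sup_ubound; exists (Z, M). Qed.

Lemma cvg_shifted_aV nu : (forall n, 0 < nu n) -> nu n @[n --> \oo] --> (0 : R) ->
  shifted_aV (nu n) @[n --> \oo] --> shifted_aV 0.
Proof.
move=> nu0 cnu; rewrite shifted_aV0 -[X in _ --> X]addr0; apply: cvgD; first exact: cvg_cst.
exact: cvg_powR0.
Qed.

Lemma cvg_action_rest nu u x : (forall n, 0 < nu n) -> nu n @[n --> \oo] --> (0 : R) ->
  cvg_triple u x -> action_rest (nu n) (u n) @[n --> \oo] --> action_rest 0 x.
Proof.
move=> nu0 cnu [cE cB cc]; have cv := cvg_shifted_aV nu0 cnu.
have c2 : 2 * nu n @[n --> \oo] --> 2 * (0 : R) by exact: seq_cvgZ.
have c3 : shifted_aV (nu n) / 2 @[n --> \oo] --> shifted_aV 0 / 2.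
  by apply: cvgM => //; exact: cvg_cst.
have h1 : cvgI mu (fun n q => (\sum_i V0 q.2 0 i * tE (u n) q 0 i)
                 + 2 * nu n * (\sum_i \sum_l gradV0 q.2 i l * tchi (u n) q i l))
    (fun q => (\sum_i V0 q.2 0 i * tE x q 0 i)
                 + 2 * 0 * (\sum_i \sum_l gradV0 q.2 i l * tchi x q i l)).
  apply: cvgID; first by apply: cvgI_sum => i; apply: cvgI_mul => //; apply: cvgL2_cst; exact: L2_snd (LV0 0 i).
  apply: cvgIZ => //; apply: cvgI_sum => i; apply: cvgI_sum => l.
  by apply: cvgI_mul => //; apply: cvgL2_cst; exact: L2_snd (LG0 i l).
have h2 : cvgI mu (fun n q => (2 * aW)^-1 * frob (tchi (u n) q - tB (u n) q - aW *: Wbar q) ^+ 2)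
    (fun q => (2 * aW)^-1 * frob (tchi x q - tB x q - aW *: Wbar q) ^+ 2).
  apply: cvgIZ; first exact: cvg_cst.
  have cL i j : cvgL2 mu (fun n q => tchi (u n) q i j - tB (u n) q i j - aW * Wbar q i j)
      (fun q => tchi x q i j - tB x q i j - aW * Wbar q i j).
    by apply: cvgL2B; [exact: cvgL2B|apply: cvgL2_cst; exact: L2Z].
  have := cvgI_sum (fun i => cvgI_sum (fun j => cvgI_mul (cL i j) (cL i j))).
  by move/cvgI_ext; apply => [n q|q]; rewrite frob_sqr; apply: eq_bigr => i _;
    apply: eq_bigr => j _; rewrite !mxE expr2.
have If (m n : nat) (F : X -> 'M[R]_(m, n)) : Lp_field mu 2%:E F ->
    cvgI mu (fun=> fun q => frob (F q) ^+ 2) (fun q => frob (F q) ^+ 2).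
  move=> LF; apply: cvgI_cst.
  have := intble_sum (fun i => intble_sum (fun j => L2_sqr_integrable (LF i j))).
  by apply: intble_eq => q; rewrite frob_sqr.
have h3 : cvgI mu (fun n q => shifted_aV (nu n) / 2 * frob (Vbar q) ^+ 2 + aW / 2 * frob (Wbar q) ^+ 2)
    (fun q => shifted_aV 0 / 2 * frob (Vbar q) ^+ 2 + aW / 2 * frob (Wbar q) ^+ 2).
  by apply: cvgID; apply: cvgIZ; [exact: c3|exact: If|exact: cvg_cst|exact: If].
case: h1 => _ _ h1; case: h2 => _ _ h2; case: h3 => _ _ h3.
by apply: cvgB; [apply: cvgD|].
Qed.

Lemma cvg_pairing nu u x Z M : (forall n, 0 < nu n) -> nu n @[n --> \oo] --> (0 : R) ->
  cvg_triple u x -> admissible T (Z, M) ->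
  \int[mu]_q pairing (fun q => tE (u n) q - shifted_aV (nu n) *: Vbar q) (Nmat (shifted_aV (nu n)) (tB (u n))) Z M q
    @[n --> \oo] -->
  \int[mu]_q pairing (fun q => tE x q - shifted_aV 0 *: Vbar q) (Nmat (shifted_aV 0) (tB x)) Z M q.
Proof.
move=> nu0 cnu [cE cB cc] [[/= cZ cM] _ _ _]; have cv := cvg_shifted_aV nu0 cnu.
rewrite Rintegral_pairing_clamp; under eq_cvg do rewrite Rintegral_pairing_clamp.
suff [] : cvgI mu (fun n => pairing (fun q => tE (u n) q - shifted_aV (nu n) *: Vbar q)
    (Nmat (shifted_aV (nu n)) (tB (u n))) (Z \o clamp T) (M \o clamp T))
  (pairing (fun q => tE x q - shifted_aV 0 *: Vbar q) (Nmat (shifted_aV 0) (tB x)) (Z \o clamp T) (M \o clamp T)) by [].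
apply: cvgI_pairing => //.
  move=> i; have := cvgL2B (cE i) (cvgL2_scal cv (LV 0 i)).
  by move/cvgL2_ext; apply => [n q|q]; rewrite !mxE.
move=> i j.
have c1 : (i == j)%:R * shifted_aV (nu n) @[n --> \oo] --> (i == j)%:R * shifted_aV 0 by exact: seq_cvgZ.
have := cvgL2D (cvgL2_scal c1 (L2_cst (spacetime_measure_lty T d) 1)) (cvgL2Z 2 (cB i j)).
by move/cvgL2_ext; apply => [n q|q]; rewrite !mxE mulr1 mulr_natl.
Qed.

Definition weak_lhs (x : triple R d) (psi : 'I_d -> 'I_d -> R * 'rV[R]_d -> R) : R :=
  - (\int[mu]_q (\sum_i \sum_j tB x q i j * dt (psi i j) (point_of q))).

Definition weak_rhs (nu : R) (x : triple R d) (psi : 'I_d -> 'I_d -> R * 'rV[R]_d -> R)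
    (phi : R * 'rV[R]_d -> R) : R :=
  \int[mu]_q
    (- (\sum_i \sum_j tE x q 0 i * dx j (psi i j) (point_of q))
     + \sum_l tE x q 0 l * dx l phi (point_of q)
     + 2 * nu * (\sum_l \sum_k tchi x q l k * dx l (dx k phi) (point_of q))
     - 2 * nu * (\sum_l \sum_i \sum_j
                   tchi x q l i * dx l (dx j (psi i j)) (point_of q))).

Definition potential (psi : 'I_d -> 'I_d -> R * 'rV[R]_d -> R) : R * 'rV[R]_d -> R :=
  inv_laplacian (fun p => \sum_i \sum_j dx i (dx j (psi i j)) p).

Lemma weak_eqE nu x : weak_eq T nu x = (forall psi, test_field psi ->
  weak_lhs x psi = weak_rhs nu x psi (potential psi)).
Proof. by []. Qed.

(** Stated for the defect of the equation, so that a nonzero defect at the limit can be carried back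
    to the sequence. *)
Lemma cvg_weak_eq nu u x : (forall n, 0 < nu n) -> nu n @[n --> \oo] --> (0 : R) ->
  cvg_triple u x -> forall psi, test_field psi ->
  weak_lhs (u n) psi - weak_rhs (nu n) (u n) psi (potential psi) @[n --> \oo] -->
  weak_lhs x psi - weak_rhs 0 x psi (potential psi).
Proof.
move=> nu0 cnu [cE cB cc] psi [sp pp _ _].
have tpsi i j : testfun (psi i j) by split.
have tphi : testfun (potential psi) by exact: inv_laplacian_testfun.
have c2 : 2 * nu n @[n --> \oo] --> 2 * (0 : R) by exact: seq_cvgZ.
apply: cvgB.
  apply: cvgN; suff [] : cvgI mu
    (fun n q => \sum_i \sum_j tB (u n) q i j * dt (psi i j) (point_of q))
    (fun q => \sum_i \sum_j tB x q i j * dt (psi i j) (point_of q)) by [].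
  apply: cvgI_sum => i; apply: cvgI_sum => j; apply: cvgI_testfun => //.
  exact: testfun_dt.
suff [] : cvgI mu
  (fun n q => - (\sum_i \sum_j tE (u n) q 0 i * dx j (psi i j) (point_of q))
     + \sum_l tE (u n) q 0 l * dx l (potential psi) (point_of q)
     + 2 * nu n * (\sum_l \sum_k tchi (u n) q l k * dx l (dx k (potential psi)) (point_of q))
     - 2 * nu n * (\sum_l \sum_i \sum_j
                   tchi (u n) q l i * dx l (dx j (psi i j)) (point_of q)))
  (fun q => - (\sum_i \sum_j tE x q 0 i * dx j (psi i j) (point_of q))
     + \sum_l tE x q 0 l * dx l (potential psi) (point_of q)
     + 2 * 0 * (\sum_l \sum_k tchi x q l k * dx l (dx k (potential psi)) (point_of q))
     - 2 * 0 * (\sum_l \sum_i \sum_j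
                   tchi x q l i * dx l (dx j (psi i j)) (point_of q))) by [].
apply: cvgIB; [apply: cvgID; [apply: cvgID|]|].
- apply: cvgIN; apply: cvgI_sum => i; apply: cvgI_sum => j; apply: cvgI_testfun => //.
  exact: testfun_dx.
- by apply: cvgI_sum => l; apply: cvgI_testfun => //; exact: testfun_dx.
- apply: cvgIZ => //; apply: cvgI_sum => l; apply: cvgI_sum => k.
  exact: (cvgI_testfun (cc l k) (testfun_dx l (testfun_dx k tphi))).
- apply: cvgIZ => //; apply: cvgI_sum => l; apply: cvgI_sum => i; apply: cvgI_sum => j.
  exact: (cvgI_testfun (cc l i) (testfun_dx l (testfun_dx j (tpsi i j)))).
Qed.

Local Notation Fnu := (action_NS_ext T aV aW alpha Vbar Wbar V0 gradV0).

Lemma action_liminf nu u x : (forall n, 0 < nu n) -> nu n @[n --> \oo] --> (0 : R) ->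
  EBPsi_union T x -> (forall n, EBPsi_union T (u n)) -> dist_cvg (EBPsi_dist T) u x ->
  (Fnu 0 x <= limn_einf (fun n => Fnu (nu n) (u n)))%E.
Proof.
move=> nu0 cnu Dx Du du.
have cu : cvg_triple u x.
  by apply: dist_cvg_triple => // [n|]; exact: EBPsi_union_L2.
rewrite {1}/action_NS_ext; case: ifPn => [_|xN].
  (* With the real part of the action moved to the other side, the supremum is bounded one
     admissible pair at a time. *)
  rewrite action_NSE -leeBrDr//; apply: ge_ereal_sup => _ [[Z M] adm <-].
  rewrite leeBrDr// -EFinD.
  have c1 := cvg_pairing nu0 cnu cu adm; have c2 := cvg_action_rest nu0 cnu cu.
  have c3 := seq_cvgD (seq_cvgZ (c := 2^-1) c1) c2.
  have [e _] := cvg_limn_einf_sup (seq_cvg_EFin c3); rewrite -[leLHS]e.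
  apply: le_limn_einf => n; rewrite /action_NS_ext; case: ifPn => _; last exact: leey.
  by rewrite action_NSE EFinD leeD2r//; exact: calM_ge.
rewrite leye_eq; apply/eqP.
(* A test field that detects the failure of the inviscid equation at the limit detects a failure
   along the sequence from some index on, where the extended action is then infinite. *)
suff /cvg_limn_einf_sup[-> //] : Fnu (nu n) (u n) @[n --> \oo] --> +oo%E.
have [psi [tpsi npsi]] : exists psi, test_field psi /\
    weak_lhs x psi - weak_rhs 0 x psi (potential psi) != 0.
  (* The other clauses of membership do not mention the viscosity and are inherited from the union,
     so the weak equation must be what fails. *)
  apply: contrapT => H; move/negP: xN; apply; rewrite inE.
  have [nu' _ [LE LB Lc sx _]] := Dx; split => // psi tpsi; apply/eqP.
  rewrite -subr_eq0; apply/negPn/negP => K; apply: H; exists psi; split => //.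
have c := cvg_weak_eq nu0 cnu cu tpsi.
have nz : \forall n \near \oo, weak_lhs (u n) psi - weak_rhs (nu n) (u n) psi (potential psi) != 0.
  exact: (cvgr_neq0 _ c).
apply: cvg_near_cst; apply: filterS nz => n nz; rewrite /action_NS_ext; case: ifPn => //.
rewrite inE => -[_ _ _ _]; rewrite weak_eqE => /(_ _ tpsi) e.
by move: nz; rewrite e subrr eqxx.
Qed.

End action.
End fields.

(** * Recovery sequences *)

(* Almost minimizing [J n] for each [n] replaces a diagonal extraction. *)
Lemma near_minimizer (R : realType) (Y : Type) (P : Y -> Prop) (J : nat -> Y -> R) :
  (forall n y, P y -> 0 <= J n y) ->
  (forall e : R, 0 < e -> exists2 y, P y & \forall n \near \oo, J n y <= e) ->
  exists2 u : nat -> Y, forall n, P (u n) & J n (u n) @[n --> \oo] --> (0 : R).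
Proof.
move=> J0 Je.
have /choice[u Hu] : forall n, exists y, P y /\ forall y', P y' -> J n y <= J n y' + harmonic n.
  move=> n; pose S := [set J n y | y in P].
  have [y0 Py0 _] := Je 1 ltr01.
  have hS : has_inf S.
    by split; [exists (J n y0), y0|exists 0 => _ [y Py <-]; exact: J0].
  have h0 : 0 < @harmonic R n by exact: harmonic_gt0.
  have [_ [y Py <-] Hy] := inf_adherent h0 hS.
  exists y; split => // y' Py'; apply: (le_trans (ltW Hy)); rewrite lerD2r.
  by apply: ge_inf; [case: hS|exists y'].
exists u => [n|]; first by case: (Hu n).
apply/cvgrPdist_le => e e0; have e2 : 0 < e / 2 by rewrite divr_gt0.
(* The competitor [y] is fixed: for large [n] near-minimality bounds the value at [u n] by e/2 plus
   the tolerance 1/(n+1). *)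
have [y Py Hy] := Je _ e2.
have hh : \forall n \near \oo, @harmonic R n <= e / 2.
  have : \forall n \near \oo, @harmonic R n < e / 2 by exact: (cvgr_lt _ (@cvg_harmonic R)).
  by apply: filterS => n /ltW.
near=> n; have [Pn Hn] := Hu n; rewrite sub0r normrN ger0_norm ?J0//.
rewrite (le_trans (Hn _ Py))// [e]splitr lerD//; by near: n.
Unshelve. all: by end_near. Qed.

Lemma sumrB_scale_exchange (R : comNzRingType) (I K : finType) (c : R) (f : I -> R) (g : I -> K -> R) :
  \sum_i (f i - c * \sum_k g i k) = \sum_i f i - c * \sum_k \sum_i g i k.
Proof. by rewrite sumrB -mulr_sumr exchange_big. Qed.

Section recovery.
Context {R : realType} {d : nat}.
Variable T : R.
Hypothesis T0 : 0 < T.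
Local Notation mu := (spacetime_measure T d).
Local Notation X := (spacetime R d).
Local Notation L2 := (Lfun mu 2%:E).
Implicit Types (W : 'I_d -> 'I_d -> X -> R) (G : 'I_d -> X -> R).

(** [G] is the weak divergence of the symmetric field [W], contracted on the first index of [W], as
    the viscous terms are. *)
Definition div_field W G := [/\ forall i j, W i j \in L2, forall i j, W i j =1 W j i,
  forall i, G i \in L2 &
  forall i phi, testfun phi -> \int[mu]_q (G i q * phi (point_of q)) =
    - \sum_l \int[mu]_q (W l i q * dx l phi (point_of q))].

Lemma div_field_dense (C : X -> 'M[R]_d) : Lp_field mu 2%:E C ->
  {ae mu, forall q, C q \is symmetricmx} -> forall e : R, 0 < e ->
  exists W G, div_field W G /\ \sum_i \sum_j \int[mu]_q ((C q i j - W i j q) ^+ 2) <= e.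
Proof.
(* The successor keeps the divisor nonzero for every [d]; there are d^2 entries to approximate. *)
move=> LC sC e e0; pose e' := e / (d * d).+1%:R.
have e'0 : 0 < e' by rewrite divr_gt0.
have /choice[w Hw] : forall p : 'I_d * 'I_d, exists w : X -> R,
    weakly_diff T w /\ \int[mu]_q ((C q p.1 p.2 - w q) ^+ 2) <= e'.
  by move=> p; have [_ /(_ _ e'0)[w ww Hw]] := L2_approximable (LC p.1 p.2); exists w.
have Lw p : w p \in L2 by case: (Hw p) => -[].
(* The entries were approximated independently, so symmetry has to be restored by averaging. *)
pose W i j q := 2^-1 * (w (i, j) q + w (j, i) q).
have wW i j : weakly_diff T (W i j).
  by apply/weakly_diffZ/weakly_diffD; [case: (Hw (i, j))|case: (Hw (j, i))].
have LW i j : W i j \in L2 by case: (wW i j).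
have /choice[g Hg] : forall p : 'I_d * 'I_d, exists g : X -> R,
    g \in L2 /\ weak_dx T p.1 (W p.1 p.2) g.
  by move=> p; have [_ /(_ p.1)[g Lg Hg]] := wW p.1 p.2; exists g.
exists W, (fun i q => \sum_l g (l, i) q); split.
  split => //.
  - by move=> i j q; rewrite /W addrC.
  - by move=> i; apply: L2_sum => l; case: (Hg (l, i)).
  - move=> i phi tp; under eq_Rintegral do rewrite mulr_suml.
    rewrite Rintegral_sum; last first.
      by move=> l; apply: L2_intble; apply: L2_testfun => //; case: (Hg (l, i)).
    by rewrite -sumrN; apply: eq_bigr => l _; have [_ ->] := Hg (l, i).
(* As [C] is symmetric almost everywhere, [C - W] is the mean of two entry errors, and averaging
   keeps the tolerance. *)
have bound i j : \int[mu]_q ((C q i j - W i j q) ^+ 2) <= e'.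
  pose f q := 2^-1 * (C q i j - w (i, j) q); pose h q := 2^-1 * (C q j i - w (j, i) q).
  have Lf : f \in L2 by apply/L2Z/L2B.
  have Lh : h \in L2 by apply/L2Z/L2B.
  have quarter (k l : 'I_d) : \int[mu]_q ((2^-1 * (C q k l - w (k, l) q)) ^+ 2) <= e' / 4.
    rewrite (_ : Rintegral _ _ _ = 4^-1 * \int[mu]_q ((C q k l - w (k, l) q) ^+ 2)); last first.
      rewrite -RintegralZl//; last exact: L2_sqr_integrable (L2B _ _).
      by apply: eq_Rintegral => q _; field.
    by rewrite mulrC ler_pM2r ?invr_gt0//; case: (Hw (k, l)).
  rewrite (ae_eq_Rintegral (g := fun q => (f q + h q) ^+ 2)).
  - apply: (le_trans (Rintegral_sqrD Lf Lh)).
    rewrite (_ : e' = 2 * (e' / 4) + 2 * (e' / 4)); last by field.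
    by rewrite lerD// ler_wpM2l//; exact: quarter.
  - by apply: measurable_funX; exact: L2_measurable (L2B _ _).
  - by apply: measurable_funX; exact: L2_measurable (L2D Lf Lh).
  - apply: filterS sC => q; rewrite is_hermitianmxE => /eqP sC; congr (_ ^+ 2).
    have Cji : C q j i = C q i j by rewrite [in LHS]sC !mxE mul1r.
    by rewrite /f /h /W Cji; field.
apply: (@le_trans _ _ (\sum_(i < d) \sum_(j < d) e')).
  by apply: ler_sum => i _; apply: ler_sum => j _.
rewrite !sumr_const !card_ord -mulrnA /e' -[leLHS]mulr_natr mulrAC ler_pdivrMr//.
by rewrite ler_pM2l// ler_nat.
Qed.

Definition recovery (nu : R) (x : triple R d) W G : triple R d :=
  Triple (fun q => \row_i (tE x q 0 i + 2 * nu * G i q)) (tB x) (fun q => \matrix_(i, j) W i j q).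

Lemma weak_rhsE nu (x : triple R d) psi phi : L2_triple T x ->
  (forall i j, testfun (psi i j)) -> testfun phi ->
  weak_rhs T nu x psi phi =
    - (\sum_i \sum_j \int[mu]_q (tE x q 0 i * dx j (psi i j) (point_of q)))
     + \sum_l \int[mu]_q (tE x q 0 l * dx l phi (point_of q))
     + 2 * nu * (\sum_l \sum_k \int[mu]_q (tchi x q l k * dx l (dx k phi) (point_of q)))
     - 2 * nu * (\sum_l \sum_i \sum_j
                   \int[mu]_q (tchi x q l i * dx l (dx j (psi i j)) (point_of q))).
Proof.
move=> [LE _ Lc] tpsi tphi.
have I f ph : f \in L2 -> testfun ph -> mu.-integrable setT (EFin \o (fun q => f q * ph (point_of q))).
  by move=> Lf tp; exact: L2_intble (L2_testfun Lf tp).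
have I1 i j := I _ _ (LE 0 i) (testfun_dx j (tpsi i j)).
have I2 l := I _ _ (LE 0 l) (testfun_dx l tphi).
have I3 l k := I _ _ (Lc l k) (testfun_dx l (testfun_dx k tphi)).
have I4 l i j := I _ _ (Lc l i) (testfun_dx l (testfun_dx j (tpsi i j))).
have J1 := intble_sum (fun i => intble_sum (I1 i)).
have J2 := intble_sum I2.
have J3 := intble_sum (fun l => intble_sum (I3 l)).
have J4 := intble_sum (fun l => intble_sum (fun i => intble_sum (I4 l i))).
have K1 := intbleD (intbleN J1) J2; have K3 := intbleZ (2 * nu) J3; have K4 := intbleZ (2 * nu) J4.
have K2 := intbleD K1 K3.
rewrite /weak_rhs RintegralB// RintegralD// RintegralD//; last exact: intbleN.
rewrite RintegralN// !RintegralZl//.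
congr (- _ + _ + _ * _ - _ * _).
- rewrite (Rintegral_sum (fun i => intble_sum (I1 i))).
  by apply: eq_bigr => i _; rewrite (Rintegral_sum (I1 i)).
- by rewrite (Rintegral_sum I2).
- rewrite (Rintegral_sum (fun l => intble_sum (I3 l))).
  by apply: eq_bigr => l _; rewrite (Rintegral_sum (I3 l)).
- rewrite (Rintegral_sum (fun l => intble_sum (fun i => intble_sum (I4 l i)))).
  apply: eq_bigr => l _; rewrite (Rintegral_sum (fun i => intble_sum (I4 l i))).
  by apply: eq_bigr => i _; rewrite (Rintegral_sum (I4 l i)).
Qed.

Lemma recovery_L2 nu x W G : L2_triple T x -> div_field W G -> L2_triple T (recovery nu x W G).
Proof.
move=> [LE LB Lc] [LW _ LG _]; split => //= i j.
  by rewrite ord1; apply: L2_eq (L2D (LE 0 j) (L2Z (2 * nu) (LG j))) => q; rewrite mxE.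
by apply: L2_eq (LW i j) => q; rewrite mxE.
Qed.

(* Integration by parts trades the viscous terms in chi for the divergence
   that [recovery] adds to the first component. *)
Lemma recovery_weak_eq nu x W G : L2_triple T x -> div_field W G ->
  weak_eq T 0 x -> weak_eq T nu (recovery nu x W G).
Proof.
move=> Lx dW; rewrite !weak_eqE => H psi tpsi; have := H _ tpsi.
rewrite /weak_lhs /= => ->; set phi := potential psi.
have tphi : testfun phi by exact: inv_laplacian_testfun.
have tps i j : testfun (psi i j) by case: tpsi.
have [LW _ LG HG] := dW; have [LE _ _] := Lx.
have PE i ph : testfun ph -> \int[mu]_q (tE (recovery nu x W G) q 0 i * ph (point_of q)) =
    \int[mu]_q (tE x q 0 i * ph (point_of q)) -
    2 * nu * \sum_l \int[mu]_q (W l i q * dx l ph (point_of q)).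
  move=> tp; rewrite -mulrN -HG// -RintegralZl//; last exact: L2_intble (L2_testfun _ _).
  rewrite -RintegralD//; [|exact: L2_intble (L2_testfun _ _)|by apply: intbleZ; exact: L2_intble (L2_testfun _ _)].
  by apply: eq_Rintegral => q _; rewrite mxE; ring.
have PW i j ph : \int[mu]_q (tchi (recovery nu x W G) q i j * ph (point_of q)) =
    \int[mu]_q (W i j q * ph (point_of q)).
  by apply: eq_Rintegral => q _; rewrite mxE.
pose A := \sum_i \sum_j \int[mu]_q (tE x q 0 i * dx j (psi i j) (point_of q)).
pose B := \sum_l \int[mu]_q (tE x q 0 l * dx l phi (point_of q)).
pose C1 := \sum_l \sum_k \int[mu]_q (W l k q * dx l (dx k phi) (point_of q)).
pose C2 := \sum_l \sum_i \sum_j \int[mu]_q (W l i q * dx l (dx j (psi i j)) (point_of q)).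
have inviscid (a b c e : R) : a + b + 2 * 0 * c - 2 * 0 * e = a + b by ring.
rewrite (weak_rhsE 0 Lx tps tphi) inviscid -/A -/B; apply/esym.
apply: (etrans (weak_rhsE nu (recovery_L2 nu Lx dW) tps tphi)).
(* The cancellation itself: each correction coming from the first component has the coefficient of
   one viscous term and the opposite sign. *)
have combine (a b c e p r s t : R) : p = a - 2 * nu * e -> r = b - 2 * nu * c ->
    s = c -> t = e -> - p + r + 2 * nu * s - 2 * nu * t = - a + b.
  by move=> -> -> -> ->; ring.
apply: (combine _ _ C1 C2).
- have H1 i : \sum_j \int[mu]_q (tE (recovery nu x W G) q 0 i * dx j (psi i j) (point_of q)) =
      \sum_j \int[mu]_q (tE x q 0 i * dx j (psi i j) (point_of q)) -
      2 * nu * \sum_l \sum_j \int[mu]_q (W l i q * dx l (dx j (psi i j)) (point_of q)).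
    apply: (etrans (eq_bigr _ (fun j _ => PE i _ (testfun_dx j (tps i j))))).
    exact: (sumrB_scale_exchange (2 * nu)
      (fun j => \int[mu]_q (tE x q 0 i * dx j (psi i j) (point_of q)))
      (fun j l => \int[mu]_q (W l i q * dx l (dx j (psi i j)) (point_of q)))).
  apply: (etrans (eq_bigr _ (fun i _ => H1 i))).
  exact: (sumrB_scale_exchange (2 * nu)
    (fun i => \sum_j \int[mu]_q (tE x q 0 i * dx j (psi i j) (point_of q)))
    (fun i l => \sum_j \int[mu]_q (W l i q * dx l (dx j (psi i j)) (point_of q)))).
(* Once the sums are exchanged this matches [C1] up to the names of the indices, with the
   derivatives in the same order. *)
- apply: (etrans (eq_bigr _ (fun l _ => PE l _ (testfun_dx l tphi)))).
  exact: (sumrB_scale_exchange (2 * nu)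
    (fun l => \int[mu]_q (tE x q 0 l * dx l phi (point_of q)))
    (fun l k => \int[mu]_q (W k l q * dx k (dx l phi) (point_of q)))).
- by apply: eq_bigr => l _; apply: eq_bigr => k _; exact: PW.
- by apply: eq_bigr => l _; apply: eq_bigr => i _; apply: eq_bigr => j _; exact: PW.
Qed.

Lemma recovery_EBPsi nu x W G : EBPsi T 0 x -> div_field W G -> EBPsi T nu (recovery nu x W G).
Proof.
move=> Ex dW; have Lx := EBPsi_L2 Ex; have [LE' _ Lc'] := recovery_L2 nu Lx dW.
case: Ex => LE LB Lc sx we; split => //; last exact: recovery_weak_eq.
apply: filterS sx => q [sB _]; split => //; case: dW => _ sW _ _.
by rewrite is_hermitianmxE; apply/eqP/matrixP => i j; rewrite !mxE expr0 mul1r sW.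
Qed.

End recovery.

(** * The upper bound for the action *)

Section limsup.
Context {R : realType} {d : nat}.
Variable T : R.
Hypothesis T0 : 0 < T.
Local Notation mu := (spacetime_measure T d).
Local Notation X := (spacetime R d).
Local Notation L2 := (Lfun mu 2%:E).

Lemma intble_pairing (E : X -> 'rV[R]_d) (N : X -> 'M[R]_d) Z M :
  Lp_field mu 2%:E E -> Lp_field mu 2%:E N -> admissible T (Z, M) ->
  mu.-integrable setT (EFin \o pairing E N (Z \o clamp T) (M \o clamp T)).
Proof.
move=> LE LN [[/= cZ cM] _ _ _].
(* Applied to constant sequences, the bundled convergence statement yields integrability. *)
have [] // := @cvgI_pairing _ _ _ T0 (fun=> E) E (fun=> N) N Z M _ _ cZ cM.
  by move=> i; apply: cvgL2_cst; exact: LE.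
by move=> i j; apply: cvgL2_cst; exact: LN.
Qed.

Lemma psd_diag (A : 'M[R]_d) i : psd A -> 0 <= A i i.
Proof.
move=> /(_ (delta_mx 0 i)); rewrite -rowE trmx_delta -colE !mxE//.
Qed.

(* [calM] is a supremum of linear functionals, hence subadditive, and completing
   the square bounds it at [(F, c Id)]. *)
Lemma calM_perturb (E F : X -> 'rV[R]_d) (a c : R) (B : X -> 'M[R]_d) : 0 < c ->
  Lp_field mu 2%:E E -> Lp_field mu 2%:E F -> Lp_field mu 2%:E B ->
  (calM T (fun q => E q + F q)%R (Nmat (a + c) B) <=
   calM T E (Nmat a B) + ((2 * c)^-1 * \sum_i \int[mu]_q (F q 0 i ^+ 2))%:E)%E.
Proof.
move=> c0 LE LF LB; apply: ge_ereal_sup => _ [[Z M] adm <-].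
(* The same pair is used as a competitor in [calM] at [E], which reduces the claim to a pointwise
   inequality of integrands. *)
apply: le_trans (leeD2r _ (calM_ge E (Nmat a B) adm)).
have LN b : Lp_field mu 2%:E (Nmat b B).
  move=> i j; apply: L2_eq (L2D (L2_cst (spacetime_measure_lty T d) ((i == j)%:R * b)) (L2Z 2 (LB i j))) => q.
  by rewrite !mxE mulr_natl.
have LEF : Lp_field mu 2%:E (fun q => E q + F q).
  by move=> i j; apply: L2_eq (L2D (LE i j) (LF i j)) => q; rewrite mxE.
have e1 := Rintegral_pairing_clamp T (fun q => E q + F q) (Nmat (a + c) B) Z M.
have e0 := Rintegral_pairing_clamp T E (Nmat a B) Z M.
rewrite /= -EFinD lee_fin e0 -/(pairing (fun q => E q + F q) (Nmat (a + c) B) Z M) e1.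
have IF : mu.-integrable setT (EFin \o (fun q => \sum_i F q 0 i ^+ 2)).
  by apply: intble_sum => i; exact: L2_sqr_integrable (LF 0 i).
rewrite -Rintegral_sum; last by move=> i; exact: L2_sqr_integrable (LF 0 i).
rewrite invfM -mulrA -mulrDr ler_pM2l ?invr_gt0// -RintegralZl//.
have I1 := intble_pairing LEF (LN (a + c)) adm; have I2 := intble_pairing LE (LN a) adm.
rewrite -RintegralD//; last exact: intbleZ.
apply: le_Rintegral => //; first by apply: intbleD => //; exact: intbleZ.
(* Clamping makes the matrix inequality available at every point, not only at times in [0, T]. *)
move=> q _; have [_ _ _ /(_ _ (clamp_slab T0 (point_of q)))/=] := adm.
set p := clamp T (point_of q) => psdM; rewrite /pairing /= -/p.
set z := Z p; set m := M p.
(* Only the diagonal of the constraint is needed, because the gap between the two weights is a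
   multiple of the identity. *)
have mz i : z 0 i ^+ 2 <= m i i.
  have := psd_diag i psdM; rewrite !mxE subr_ge0 big_ord1 !mxE.
  by rewrite -expr2.
have -> : \sum_i \sum_j Nmat (a + c) B q i j * m i j =
    \sum_i \sum_j Nmat a B q i j * m i j + \sum_i c * m i i.
  rewrite -big_split /=; apply: eq_bigr => i _.
  rewrite [X in _ = _ + X](_ : _ = \sum_j (i == j)%:R * c * m i j); last first.
    rewrite (bigD1 i)//= eqxx mul1r big1 ?addr0// => j ji.
    by rewrite eq_sym (negbTE ji) !mul0r.
  rewrite -big_split /=; apply: eq_bigr => j _; rewrite !mxE.
  by case: (i == j); rewrite /= ?mulr1n ?mulr0n; ring.
have -> : \sum_i 2 * (E q + F q)%R 0 i * z 0 i = \sum_i 2 * E q 0 i * z 0 i + \sum_i 2 * F q 0 i * z 0 i.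
  by rewrite -big_split /=; apply: eq_bigr => i _; rewrite mxE; ring.
suff H : \sum_i 2 * F q 0 i * z 0 i - \sum_i c * m i i <= c^-1 * \sum_i F q 0 i ^+ 2.
  by rewrite opprD addrACA lerD2l.
rewrite -sumrB mulr_sumr; apply: ler_sum => i _.
apply: (@le_trans _ _ (2 * F q 0 i * z 0 i - c * z 0 i ^+ 2)).
  by rewrite lerD2l lerN2 ler_pM2l.
rewrite -subr_ge0.
have -> : c^-1 * F q 0 i ^+ 2 - (2 * F q 0 i * z 0 i - c * z 0 i ^+ 2) =
   c^-1 * (F q 0 i - c * z 0 i) ^+ 2 by field; rewrite gt_eqF.
by rewrite mulr_ge0 ?sqr_ge0// invr_ge0 ltW.
Qed.

Section action.
Variables (aV aW alpha : R).
Hypotheses (alpha0 : 0 < alpha) (alpha2 : alpha < 2).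
Variables (Vbar : X -> 'rV[R]_d) (Wbar : X -> 'M[R]_d).
Variables (V0 : torus R d -> 'rV[R]_d) (gradV0 : torus R d -> 'M[R]_d).
Hypotheses (LV : Lp_field mu 2%:E Vbar) (LW : Lp_field mu 2%:E Wbar).
Hypotheses (LV0 : Lp_field (cube_measure d) 2%:E V0).
Hypotheses (LG0 : Lp_field (cube_measure d) 2%:E gradV0).
Local Notation Fnu := (action_NS_ext T aV aW alpha Vbar Wbar V0 gradV0).
Implicit Types (W : 'I_d -> 'I_d -> X -> R) (G : 'I_d -> X -> R).

(** The zero pair is admissible. In the upper bound this leaves only finite values and +oo to
    consider. *)
Lemma calM_ge0 (E : X -> 'rV[R]_d) (N : X -> 'M[R]_d) : (0 <= calM T E N)%E.
Proof.
have adm : @admissible R d T (fun=> 0, fun=> 0).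
  split => //=; first by split; apply: continuous_subspaceT => p; exact: cst_continuous.
  - by move=> p _; rewrite is_hermitianmxE; apply/eqP/matrixP => i j; rewrite !mxE mulr0.
  - by move=> p _ v; rewrite mulmx0 subr0 mulmx0 mul0mx mxE.
apply: le_trans (calM_ge E N adm); rewrite (_ : Rintegral _ _ _ = 0) ?mulr0//.
rewrite -[RHS](mul0r (fine (mu setT))) -Rintegral_cst//; apply: eq_Rintegral => q _.
rewrite /pairing big1 ?sub0r; last by move=> i _; rewrite mxE mulr0.
by rewrite big1 ?oppr0// => i _; rewrite big1// => j _; rewrite mxE mulr0.
Qed.

(** Passing from viscosity 0 to [nu] adds [2 nu G - nu^alpha Vbar] to the first argument of [calM]
    and [nu^alpha Id] to the second, so [calM_perturb] applies with c = nu^alpha. *)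
Lemma calM_recovery (nu : R) x W G : 0 < nu -> L2_triple T x -> div_field T W G ->
  (calM T (fun q => tE (recovery nu x W G) q - shifted_aV aV alpha nu *: Vbar q)%R
          (Nmat (shifted_aV aV alpha nu) (tB (recovery nu x W G))) <=
   calM T (fun q => tE x q - shifted_aV aV alpha 0 *: Vbar q)%R (Nmat (shifted_aV aV alpha 0) (tB x)) +
   (4 * (nu ^+ 2 / nu `^ alpha * \sum_i \int[mu]_q (G i q ^+ 2)) +
    nu `^ alpha * \sum_i \int[mu]_q (Vbar q 0 i ^+ 2))%:E)%E.
Proof.
move=> nu0 [LE LB Lc] [_ _ LG _]; set c := nu `^ alpha.
have c0 : 0 < c by exact: powR_gt0.
pose E0 q := tE x q - shifted_aV aV alpha 0 *: Vbar q.
pose F q : 'rV[R]_d := \row_i (2 * nu * G i q - c * Vbar q 0 i).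
have LE0 : Lp_field mu 2%:E E0.
  by move=> i j; apply: L2_eq (L2B (LE i j) (L2Z (shifted_aV aV alpha 0) (LV i j))) => q; rewrite !mxE.
have LF : Lp_field mu 2%:E F.
  by move=> i j; apply: L2_eq (L2B (L2Z (2 * nu) (LG j)) (L2Z c (LV 0 j))) => q; rewrite mxE.
have := calM_perturb (shifted_aV aV alpha 0) c0 LE0 LF LB.
have -> : shifted_aV aV alpha 0 + c = shifted_aV aV alpha nu by rewrite shifted_aV0.
have -> : (fun q => E0 q + F q) = (fun q => tE (recovery nu x W G) q - shifted_aV aV alpha nu *: Vbar q).
  apply/funext => q; apply/rowP => i; rewrite !mxE shifted_aV0// /shifted_aV -/c; ring.
move=> H; apply: (le_trans H); rewrite leeD2l// lee_fin.
pose SG := \sum_i \int[mu]_q (G i q ^+ 2); pose SV := \sum_i \int[mu]_q (Vbar q 0 i ^+ 2).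
rewrite -/SG -/SV.
(* The 8 is twice the square of 2; dividing by [2 c] then leaves the factors 4 and 1 of the
   statement. *)
have HS : \sum_i \int[mu]_q (F q 0 i ^+ 2) <= 8 * nu ^+ 2 * SG + 2 * c ^+ 2 * SV.
  rewrite /SG /SV !mulr_sumr -big_split; apply: ler_sum => i _ /=.
  have L1 := L2Z (2 * nu) (LG i); have L2 := L2Z c (LV 0 i).
  have sqZ (b : R) f : f \in Lfun mu 2%:E ->
      \int[mu]_q ((b * f q) ^+ 2) = b ^+ 2 * \int[mu]_q (f q ^+ 2).
    move=> Lf; rewrite -RintegralZl//; last exact: L2_sqr_integrable.
    by apply: eq_Rintegral => q _; rewrite exprMn.
  have := Rintegral_sqrD L1 (L2N L2).
  rewrite (_ : \int[mu]_q (F q 0 i ^+ 2) =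
      \int[mu]_q ((2 * nu * G i q + - (c * Vbar q 0 i)) ^+ 2)); last first.
    by apply: eq_Rintegral => q _; rewrite mxE.
  move=> K; apply: (le_trans K).
  under [X in _ + 2 * X]eq_Rintegral do rewrite sqrrN.
  rewrite (sqZ _ _ (LG i)) (sqZ _ _ (LV 0 i)) le_eqVlt; apply/orP; left; apply/eqP; ring.
apply: (@le_trans _ _ ((2 * c)^-1 * (8 * nu ^+ 2 * SG + 2 * c ^+ 2 * SV))).
  by rewrite ler_pM2l// invr_gt0 mulr_gt0.
clearbody SG SV; rewrite le_eqVlt; apply/orP; left; apply/eqP; field.
by rewrite gt_eqF.
Qed.

(** [B] does not move, chi moves by the approximation error, and E by [2 nu G], whence the weight
    nu^2 on the divergence. *)
Lemma dist_recovery (nu : nat -> R) x (W_ : nat -> 'I_d -> 'I_d -> X -> R)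
    (G_ : nat -> 'I_d -> X -> R) : L2_triple T x ->
  (forall n, div_field T (W_ n) (G_ n)) ->
  \sum_i \sum_j \int[mu]_q ((tchi x q i j - W_ n i j q) ^+ 2) @[n --> \oo] --> (0 : R) ->
  nu n ^+ 2 * \sum_i \int[mu]_q (G_ n i q ^+ 2) @[n --> \oo] --> (0 : R) ->
  dist_cvg (EBPsi_dist T) (fun n => recovery (nu n) x (W_ n) (G_ n)) x.
Proof.
move=> Lx dW cW cG; have [LE LB Lc] := Lx.
have Lu n : L2_triple T (recovery (nu n) x (W_ n) (G_ n)) by exact: recovery_L2.
rewrite /dist_cvg /EBPsi_dist.
have cE : Lp_norm mu 2%:E (fun q => tE (recovery (nu n) x (W_ n) (G_ n)) q - tE x q)
    @[n --> \oo] --> 0%E.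
  apply/(Lp_norm2_cvg0 (F_ := fun n q => tE (recovery (nu n) x (W_ n) (G_ n)) q - tE x q)).
    by move=> n; apply: Lp_fieldB => //; case: (Lu n).
  have := seq_cvgZ (c := 4) cG; rewrite mulr0; apply: cvg_eqfun => n.
  rewrite big_ord1 !mulr_sumr; apply: eq_bigr => i _.
  have [_ _ LG _] := dW n.
  rewrite -!RintegralZl//; [|by apply: intbleZ; exact: L2_sqr_integrable|exact: L2_sqr_integrable].
  by apply: eq_Rintegral => q _; rewrite !mxE; ring.
have cc : Lp_norm mu 2%:E (fun q => tchi (recovery (nu n) x (W_ n) (G_ n)) q - tchi x q)
    @[n --> \oo] --> 0%E.
  apply/(Lp_norm2_cvg0 (F_ := fun n q => tchi (recovery (nu n) x (W_ n) (G_ n)) q - tchi x q)).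
    by move=> n; apply: Lp_fieldB => //; case: (Lu n).
  apply: (cvg_eqfun _ cW) => n; apply: eq_bigr => i _; apply: eq_bigr => j _.
  by apply: eq_Rintegral => q _; rewrite !mxE; ring.
have e0 n : Lp_norm mu +oo%E (fun q => tB (recovery (nu n) x (W_ n) (G_ n)) q - tB x q) = 0%E.
  rewrite (_ : (fun q => _) = fun=> 0); first exact: Lp_norm0.
  by apply/funext => q; exact: subrr.
under eq_cvg do rewrite e0 adde0.
by have := cvgeD _ cE cc; rewrite adde0; apply.
Qed.

Lemma dist_self (x : triple R d) : EBPsi_dist T x x = 0%E.
Proof.
rewrite /EBPsi_dist.
have z m n (F : X -> 'M[R]_(m, n)) : (fun q => F q - F q) = fun=> 0.
  by apply/funext => q; exact: subrr.
by rewrite !z !Lp_norm0// !adde0.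
Qed.

Lemma action_limsup nu x : (forall n, 0 < nu n) -> nu n @[n --> \oo] --> (0 : R) ->
  EBPsi_union T x -> exists u : nat -> triple R d,
  [/\ forall n, EBPsi_union T (u n), dist_cvg (EBPsi_dist T) u x &
      (limn_esup (fun n => Fnu (nu n) (u n)) <= Fnu 0 x)%E].
Proof.
move=> nu0 cnu Dx; rewrite {2}/action_NS_ext; case: ifPn => [|_]; last first.
  (* The target value is +oo, so the constant sequence will do. *)
  exists (fun=> x); split => //; last exact: leey.
  by rewrite /dist_cvg dist_self; exact: cvg_cst.
rewrite inE => Ex; have Lx := EBPsi_L2 Ex; have [_ _ Lc] := Lx.
(* The cost of the divergence in [calM_recovery], equal to nu^(2 - alpha). *)
pose delta n := nu n ^+ 2 / nu n `^ alpha.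
have delta0 n : 0 < delta n by rewrite divr_gt0 ?exprn_gt0 ?powR_gt0.
have cdelta : delta n @[n --> \oo] --> (0 : R).
  have b0 : 0 < 2 - alpha by rewrite subr_gt0.
  apply: (cvg_eqfun _ (cvg_powR0 b0 nu0 cnu)) => n.
  rewrite /delta -powR_mulrn ?ltW// -{1}(subrK alpha 2) powRD; last by apply/implyP => _; rewrite gt_eqF.
  by rewrite mulfK// gt_eqF// powR_gt0.
have cpow := cvg_powR0 alpha0 nu0 cnu.
pose Y := (('I_d -> 'I_d -> X -> R) * ('I_d -> X -> R))%type.
pose JW (y : Y) := \sum_i \sum_j \int[mu]_q ((tchi x q i j - y.1 i j q) ^+ 2).
pose JG (y : Y) := \sum_i \int[mu]_q (y.2 i q ^+ 2).
have JW0 y : 0 <= JW y.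
  by rewrite sumr_ge0// => i _; rewrite sumr_ge0// => j _; exact: Rintegral_sqr_ge0.
have JG0 y : 0 <= JG y by rewrite sumr_ge0// => i _; exact: Rintegral_sqr_ge0.
(* Minimizing the sum balances the error in chi against the cost of the divergence: for a fixed [W]
   the cost dies out with [delta], and the error can be made as small as desired. *)
have [||y dy Jy] := @near_minimizer R Y (fun y => div_field T y.1 y.2)
    (fun n y => JW y + delta n * JG y).
- by move=> n y _; rewrite addr_ge0// mulr_ge0// ltW.
- move=> e e0; have e2 : 0 < e / 2 by rewrite divr_gt0.
  have sc : {ae mu, forall q, tchi x q \is symmetricmx}.
    by case: Ex => _ _ _ + _; apply: filterS => q [].
  have [W [G [dW HW]]] := div_field_dense Lc sc e2.
  exists (W, G) => //.
  have H : delta n * JG (W, G) @[n --> \oo] --> (0 : R).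
    by rewrite -(mul0r (JG (W, G))); apply: seq_cvgM => //; exact: cvg_cst.
  have : \forall n \near \oo, delta n * JG (W, G) < e / 2 by exact: (cvgr_lt _ H).
  by apply: filterS => n /ltW H1; rewrite [e]splitr lerD.
have cW : JW (y n) @[n --> \oo] --> (0 : R).
  by apply: (cvg_squeeze0 _ Jy) => n; rewrite JW0 lerDl mulr_ge0// ltW.
have cG : delta n * JG (y n) @[n --> \oo] --> (0 : R).
  by apply: (cvg_squeeze0 _ Jy) => n; rewrite lerDr JW0 mulr_ge0// ltW.
(* nu^2 is nu^alpha times [delta], so the distance is controlled by the same cost. *)
have cnG : nu n ^+ 2 * JG (y n) @[n --> \oo] --> (0 : R).
  have := seq_cvgM cpow cG; rewrite mulr0; apply: cvg_eqfun => n.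
  by rewrite /delta mulrA mulrCA divff ?mulr1// gt_eqF// powR_gt0.
pose u n := recovery (nu n) x (y n).1 (y n).2.
have Eu n : EBPsi T (nu n) (u n) by exact: recovery_EBPsi.
have du : dist_cvg (EBPsi_dist T) u x by exact: dist_recovery.
exists u; split => //.
  by move=> n; exists (nu n); [exact/ltW/nu0|exact: Eu].
have cu : cvg_triple T u x.
  by apply: dist_cvg_triple => // n; exact: EBPsi_L2 (Eu n).
have cr : action_rest T aV aW alpha Vbar Wbar V0 gradV0 (nu n) (u n) @[n --> \oo] -->
    action_rest T aV aW alpha Vbar Wbar V0 gradV0 0 x by exact: cvg_action_rest.
pose s n := 4 * (delta n * JG (y n)) + nu n `^ alpha * \sum_i \int[mu]_q (Vbar q 0 i ^+ 2).
have cs : s n @[n --> \oo] --> (0 : R).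
  have := seq_cvgD (seq_cvgZ (c := 4) cG) (seq_cvgM cpow (@seq_cvg_cst R (\sum_i \int[mu]_q (Vbar q 0 i ^+ 2)))).
  by rewrite mulr0 mul0r addr0.
rewrite action_NSE; set M0 := calM _ _ _.
have M00 : (0 <= M0)%E by exact: calM_ge0.
(* When [calM] is infinite at the limit the bound is trivial; otherwise it becomes a real constant
   in a real limit. *)
have [->|M0y] := eqVneq M0 +oo%E; first by rewrite addye// leey.
have M0fin : M0 \is a fin_num by rewrite ge0_fin_numE// lt_neqAle M0y leey.
have c1 := seq_cvg_EFin (seq_cvgD (@seq_cvg_cst R (fine M0)) (seq_cvgD cs cr)).
have /cvg_limn_einf_sup[_] := c1.
rewrite add0r EFinD fineK// => <-; apply: le_limn_esup => n.
rewrite /action_NS_ext mem_set; last exact: Eu.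
rewrite action_NSE; move: (action_rest _ _ _ _ _ _ _ _ (nu n) (u n)) => r.
rewrite addrA EFinD; apply: leeD2r; rewrite EFinD fineK//.
exact: (calM_recovery (nu0 n) Lx (dy n)).
Qed.

End action.
End limsup.

Theorem proposition5p1 (R : realType) (d : nat) (T aV aW alpha : R)
    (Vbar : spacetime R d -> 'rV[R]_d) (Wbar : spacetime R d -> 'M[R]_d)
    (V0 : torus R d -> 'rV[R]_d) (gradV0 : torus R d -> 'M[R]_d) :
  (d = 2%N \/ d = 3%N) ->
  0 < T -> 0 < aV -> 0 < aW ->
  Lp_field (spacetime_measure T d) 2%:E Vbar ->
  Lp_field (spacetime_measure T d) 2%:E Wbar ->
  0 < alpha -> alpha < ((d./2 + 4)%N%:R)^-1 ->
  Lp_field (cube_measure d) 2%:E V0 ->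
  divergence_free V0 ->
  zero_mean V0 ->
  weak_gradient V0 gradV0 ->
  Lp_field (cube_measure d) 2%:E gradV0 ->
  gamma_cvg_0plus (EBPsi_union T) (EBPsi_dist T)
    (action_NS_ext T aV aW alpha Vbar Wbar V0 gradV0)
    (action_NS_ext T aV aW alpha Vbar Wbar V0 gradV0 0).
Proof.
move=> _ T0 _ _ LV LW alpha0 alpha_lt LV0 _ _ _ LG0 nu nu0 cnu.
(* The denominator is at least 1, so [alpha] is below 1; the bound by 2 is what makes nu^2 /
   nu^alpha tend to 0. *)
have alpha2 : alpha < 2.
  apply: (lt_trans alpha_lt); apply: (@le_lt_trans _ _ 1); last by rewrite ltr1n.
  by rewrite invf_le1 ?ltr0n ?ler1n ?addn_gt0 ?orbT.
split => [x Dx u Du du|x Dx]; first exact: action_liminf.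
exact: action_limsup.
Qed.
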